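(* Let $U$ and $X$ be complex Hilbert spaces and let $\Sigma=(\mathbb{T},\Phi,\Psi,\mathbb{F})$ be an impedance passive well-posed linear system on $(U,X,U)$ whose transfer function $P$ satisfies $P(\lambda)+P(\lambda)^*\ge c_\lambda I$ for some $\lambda,c_\lambda>0$. Let $\phi:U\to U$ be a function for which there is a constant $\gamma>0$ such that $$\mathrm{Re}\,\langle \phi(u_2)-\phi(u_1),u_2-u_1\rangle_U\ge \gamma\|\phi(u_2)-\phi(u_1)\|_U^2,\qquad u_1,u_2\in U.$$ Then for every $x_0\in X$ and $v\in L^2_{\mathrm{loc}}(0,\infty;U)$ the equations $$x(t)=\mathbb{T}_t x_0+\Phi_t\mathbf{P}_t\phi(v-y),\quad t\ge 0,\qquad\qquad y=\Psi_\infty x_0+\mathbb{F}_\infty\phi(v-y)$$ have a unique solution $x\in C([0,\infty);X)$ and $y\in L^2_{\mathrm{loc}}(0,\infty;U)$. Moreover, if $(x_1,y_1)$ and $(x_2,y_2)$ are two pairs of solutions of these equations corresponding to initial states $x_{01},x_{02}\in X$ and inputs $v_1,v_2\in L^2_{\mathrm{loc}}(0,\infty;U)$, respectively, then for all $t\ge 0$ $$\|x_2(t)-x_1(t)\|_X^2+\gamma\int_0^t\|\phi(v_2(s)-y_2(s))-\phi(v_1(s)-y_1(s))\|_U^2\,ds\le \|x_2(0)-x_1(0)\|_X^2+\frac1\gamma\int_0^t\|v_2(s)-v_1(s)\|_U^2\,ds .$$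
   Context: $L^2_{\mathrm{loc}}(0,\infty;U)$ denotes the functions whose restriction to $(0,\tau)$ is in $L^2(0,\tau;U)$ for every $\tau>0$. $\mathbf{P}_\tau$ denotes truncation of a function to $[0,\tau]$ (identified with its extension by zero to $[0,\infty)$ when needed). For functions $u,v$ on $[0,\infty)$ and $\tau\ge 0$, let $u\diamond_\tau v$ be the function equal to $u$ on $[0,\tau)$ and to $v(\cdot-\tau)$ on $[\tau,\infty)$. A well-posed linear system on Hilbert spaces $(U,X,Y)$ is a quadruple $\Sigma=(\mathbb{T}_t,\Phi_t,\Psi_t,\mathbb{F}_t)_{t\ge0}$ of families of bounded linear operators, $\mathbb{T}_t\in\mathcal{L}(X)$, $\Phi_t\in\mathcal{L}(L^2(0,\infty;U),X)$, $\Psi_t\in\mathcal{L}(X,L^2(0,\infty;Y))$, $\mathbb{F}_t\in\mathcal{L}(L^2(0,\infty;U),L^2(0,\infty;Y))$, such that $\mathbb{T}$ is a strongly continuous semigroup, $\Psi_0=0$, $\mathbb{F}_0=0$, and for all $\tau,t\ge0$, $x\in X$, $u,v\in L^2(0,\infty;U)$: $\Phi_{\tau+t}(u\diamond_\tau v)=\mathbb{T}_t\Phi_\tau u+\Phi_t v$, $\Psi_{\tau+t}x=\Psi_\tau x\diamond_\tau\Psi_t\mathbb{T}_\tau x$, and $\mathbb{F}_{\tau+t}(u\diamond_\tau v)=\mathbb{F}_\tau u\diamond_\tau(\Psi_t\Phi_\tau u+\mathbb{F}_t v)$. The extended output map $\Psi_\infty:X\to L^2_{\mathrm{loc}}(0,\infty;Y)$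 and extended input-output map $\mathbb{F}_\infty:L^2_{\mathrm{loc}}(0,\infty;U)\to L^2_{\mathrm{loc}}(0,\infty;Y)$ are determined by $\mathbf{P}_t\Psi_\infty=\Psi_t$ and $\mathbf{P}_t\mathbb{F}_\infty=\mathbb{F}_t\mathbf{P}_t$ for all $t\ge 0$. The mild state trajectory and mild output for $x_0\in X$, $u\in L^2_{\mathrm{loc}}(0,\infty;U)$ are $x(t)=\mathbb{T}_tx_0+\Phi_t\mathbf{P}_tu$ and $y=\Psi_\infty x_0+\mathbb{F}_\infty u$. $\Sigma$ is impedance passive if $Y=U$ and every mild state trajectory $x$ and output $y$ satisfy $\|x(t)\|_X^2-\|x_0\|_X^2\le 2\,\mathrm{Re}\int_0^t\langle u(s),y(s)\rangle_U\,ds$ for all $t\ge 0$. The transfer function of an impedance passive $\Sigma$ is the analytic function $P$ on $\{\lambda\in\mathbb{C}:\mathrm{Re}\,\lambda>0\}$ with values in $\mathcal{L}(U)$ such that the Laplace transforms satisfy $\widehat{\mathbb{F}_\infty u}(\lambda)=P(\lambda)\hat u(\lambda)$ for $u\in L^2(0,\infty;U)$ and $\mathrm{Re}\,\lambda>0$. *)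

(* Defs.v *)
From HB Require Import structures.
From mathcomp Require Import all_boot all_order all_algebra.
From mathcomp Require Import sesquilinear complex.
From mathcomp Require Import all_classical all_reals all_analysis.

Set Implicit Arguments.
Unset Strict Implicit.
Unset Printing Implicit Defensive.

Import Order.TTheory GRing.Theory Num.Theory Num.Def.
Import numFieldNormedType.Exports.

Local Open Scope classical_set_scope.
Local Open Scope ring_scope.
Local Open Scope complex_scope.

HB.mixin Record CompleteNormedModule_isHilbert (R : realType) U
    & CompleteNormedModule R[i] U := {
  dotp : {dot U for (@conjC R[i])} ;
  dotpE : forall x : U, dotp x x = `|x| ^+ 2
}.

#[short(type="hilbertType")]
HB.structure Definition Hilbert (R : realType) :=
  {U of CompleteNormedModule R[i] U & CompleteNormedModule_isHilbert R U}.

Section Operators.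
Context {R : realType}.

(* The norm of a normedModType R[i] takes its values in R[i]. *)
Definition rnorm (U : hilbertType R) (x : U) : R := complex.Re `|x|.

Definition bounded_linear (U V : hilbertType R) (A : U -> V) : Prop :=
  linear A /\ exists M : R, forall x, rnorm (A x) <= M * rnorm x.

Definition is_adjoint (U V : hilbertType R) (A : U -> V) (B : V -> U) : Prop :=
  forall x y, dotp (A x) y = dotp x (B y).

(* On R[i], z <= w means that w - z is a nonnegative real. *)
Definition op_le (U : hilbertType R) (A B : U -> U) : Prop :=
  forall u, dotp (A u) u <= dotp (B u) u.

Definition cexp (z : R[i]) : R[i] :=
  (expR (complex.Re z))%:C
  * (cos (complex.Im z) +i* sin (complex.Im z)).

(* Complex differentiability on the open right half-plane, for the operator
   norm of L(U). *)
Definition holomorphic_on_C0 (U : hilbertType R) (P : R[i] -> U -> U) : Prop :=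
  forall l : R[i], 0 < complex.Re l ->
  exists2 D : U -> U, bounded_linear D &
    forall e : R, 0 < e -> exists2 d : R, 0 < d &
      forall h : R[i], h != 0 -> complex.Re `|h| < d ->
      forall u : U,
        rnorm (h^-1 *: (P (l + h) u - P l u) - D u) <= e * rnorm u.

End Operators.

Section FunctionSpaces.
Context {R : realType}.

Local Notation mu := (@lebesgue_measure R).

Definition simple_function (U : hilbertType R) (g : R -> U) : Prop :=
  finite_set (range g) /\ forall z, measurable (g @^-1` [set z]).

Definition strongly_measurable (U : hilbertType R) (D : set R) (f : R -> U) :
    Prop :=
  exists2 g : nat -> R -> U, (forall n, simple_function (g n)) &
    forall t, D t -> g n t @[n --> \oo] --> f t.

(* Elements of L^2(D; U) are represented by functions on R, whose values
   outside D are irrelevant, and equality in L^2(D; U) is equality almost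
   everywhere on D; every class has a representative which is the pointwise
   limit everywhere on D of simple functions. *)
Definition L2 (U : hilbertType R) (D : set R) (f : R -> U) : Prop :=
  strongly_measurable D f /\
  (\int[mu]_(t in D) ((rnorm (f t)) ^+ 2)%:E < +oo)%E.

Definition L2norm (U : hilbertType R) (D : set R) (f : R -> U) : R :=
  Num.sqrt (\int[mu]_(t in D) (rnorm (f t) ^+ 2)).

Definition L2loc (U : hilbertType R) (f : R -> U) : Prop :=
  forall tau : R, 0 < tau -> L2 `]0, tau[ f.

Definition trunc (U : hilbertType R) (tau : R) (f : R -> U) : R -> U :=
  fun s => if (0 <= s) && (s <= tau) then f s else 0.

Definition diamond (U : hilbertType R) (tau : R) (u v : R -> U) : R -> U :=
  fun s => if s < tau then u s else v (s - tau).

Definition Cintegral (D : set R) (f : R -> R[i]) : R[i] :=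
  (\int[mu]_(t in D) complex.Re (f t)) +i* (\int[mu]_(t in D) complex.Im (f t)).

(* The value y = 0 contributes nothing, even where g vanishes on a set of
   infinite measure. *)
Definition simple_integral (U : hilbertType R) (D : set R) (g : R -> U) : U :=
  \sum_(y \in range g) (fine (mu (D `&` g @^-1` [set y])))%:C *: y.

Definition is_bochner_integral (U : hilbertType R) (D : set R) (f : R -> U)
    (z : U) : Prop :=
  strongly_measurable D f /\
  exists g : nat -> R -> U,
    [/\ forall n, simple_function (g n),
        forall n (y : U), y != 0 -> (mu (D `&` g n @^-1` [set y]) < +oo)%E,
        (\int[mu]_(t in D) (rnorm (f t - g n t))%:E)%E @[n --> \oo] --> 0%E &
        simple_integral D (g n) @[n --> \oo] --> z].

Definition is_laplace_transform (U : hilbertType R) (f : R -> U) (l : R[i])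
    (z : U) : Prop :=
  is_bochner_integral `]0, +oo[ (fun t => cexp (- (l * t%:C)) *: f t) z.

End FunctionSpaces.

Notation halfline := (`]0, +oo[%classic).

Section WellPosed.
Context {R : realType}.

Local Notation mu := (@lebesgue_measure R).

(* Operators to and from L^2(0, oo) are maps on representatives which respect
   equality almost everywhere. *)
Record well_posed_system (U X Y : hilbertType R) := WellPosedSystem {
  sgT : R -> X -> X ;
  Phi : R -> (R -> U) -> X ;
  Psi : R -> X -> (R -> Y) ;
  FF : R -> (R -> U) -> (R -> Y) ;

  sgT_bounded : forall t : R, 0 <= t -> bounded_linear (sgT t) ;

  Phi_ae : forall (t : R) u v, 0 <= t -> L2 halfline u -> L2 halfline v ->
    u = v %[ae mu in halfline] -> Phi t u = Phi t v ;
  Phi_linear : forall (t : R) (a : R[i]) u v, 0 <= t ->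
    L2 halfline u -> L2 halfline v ->
    Phi t (fun s => a *: u s + v s) = a *: Phi t u + Phi t v ;
  Phi_bounded : forall t : R, 0 <= t -> exists M : R, forall u, L2 halfline u ->
    rnorm (Phi t u) <= M * L2norm halfline u ;

  Psi_L2 : forall (t : R) x, 0 <= t -> L2 halfline (Psi t x) ;
  Psi_linear : forall (t : R) (a : R[i]) x z, 0 <= t ->
    Psi t (a *: x + z) = (fun s => a *: Psi t x s + Psi t z s)
      %[ae mu in halfline] ;
  Psi_bounded : forall t : R, 0 <= t -> exists M : R, forall x,
    L2norm halfline (Psi t x) <= M * rnorm x ;

  FF_L2 : forall (t : R) u, 0 <= t -> L2 halfline u -> L2 halfline (FF t u) ;
  FF_ae : forall (t : R) u v, 0 <= t -> L2 halfline u -> L2 halfline v ->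
    u = v %[ae mu in halfline] -> FF t u = FF t v %[ae mu in halfline] ;
  FF_linear : forall (t : R) (a : R[i]) u v, 0 <= t ->
    L2 halfline u -> L2 halfline v ->
    FF t (fun s => a *: u s + v s) = (fun s => a *: FF t u s + FF t v s)
      %[ae mu in halfline] ;
  FF_bounded : forall t : R, 0 <= t -> exists M : R, forall u, L2 halfline u ->
    L2norm halfline (FF t u) <= M * L2norm halfline u ;

  sgT0 : forall x, sgT 0 x = x ;
  sgTD : forall (tau t : R) x, 0 <= tau -> 0 <= t ->
    sgT (tau + t) x = sgT t (sgT tau x) ;
  sgT_continuous : forall x, sgT t x @[t --> 0^'+] --> x ;

  Psi0 : forall x, Psi 0 x = (fun=> 0) %[ae mu in halfline] ;
  FF0 : forall u, L2 halfline u -> FF 0 u = (fun=> 0) %[ae mu in halfline] ;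

  PhiD : forall (tau t : R) u v, 0 <= tau -> 0 <= t ->
    L2 halfline u -> L2 halfline v ->
    Phi (tau + t) (diamond tau u v) = sgT t (Phi tau u) + Phi t v ;
  PsiD : forall (tau t : R) x, 0 <= tau -> 0 <= t ->
    Psi (tau + t) x = diamond tau (Psi tau x) (Psi t (sgT tau x))
      %[ae mu in halfline] ;
  FFD : forall (tau t : R) u v, 0 <= tau -> 0 <= t ->
    L2 halfline u -> L2 halfline v ->
    FF (tau + t) (diamond tau u v)
    = diamond tau (FF tau u) (fun s => Psi t (Phi tau u) s + FF t v s)
      %[ae mu in halfline]
}.

Definition extended_output_map (U X Y : hilbertType R)
    (S : well_posed_system U X Y) (Psioo : X -> R -> Y) : Prop :=
  forall x, L2loc (Psioo x) /\
    forall t : R, 0 <= t -> trunc t (Psioo x) = Psi S t x %[ae mu in halfline].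

Definition extended_io_map (U X Y : hilbertType R)
    (S : well_posed_system U X Y) (Foo : (R -> U) -> R -> Y) : Prop :=
  forall u, L2loc u -> L2loc (Foo u) /\
    forall t : R, 0 <= t ->
      trunc t (Foo u) = FF S t (trunc t u) %[ae mu in halfline].

Definition mild_state (U X Y : hilbertType R) (S : well_posed_system U X Y)
    (x0 : X) (u : R -> U) (t : R) : X :=
  sgT S t x0 + Phi S t (trunc t u).

Definition mild_output (U X Y : hilbertType R) (Psioo : X -> R -> Y)
    (Foo : (R -> U) -> R -> Y) (x0 : X) (u : R -> U) (s : R) : Y :=
  Psioo x0 s + Foo u s.

Definition impedance_passive (U X : hilbertType R)
    (S : well_posed_system U X U) (Psioo : X -> R -> U)
    (Foo : (R -> U) -> R -> U) : Prop :=
  forall x0 u, L2loc u -> forall t : R, 0 <= t ->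
    rnorm (mild_state S x0 u t) ^+ 2 - rnorm x0 ^+ 2
    <= 2 * complex.Re (Cintegral `]0, t[
             (fun s => dotp (u s) (mild_output Psioo Foo x0 u s))).

(* P represents an L(U)-valued function on the open right half-plane; its
   values elsewhere are irrelevant. *)
Definition transfer_function (U : hilbertType R) (Foo : (R -> U) -> R -> U)
    (P : R[i] -> U -> U) : Prop :=
  [/\ forall l, 0 < complex.Re l -> bounded_linear (P l),
      holomorphic_on_C0 P &
      forall u, L2 halfline u -> forall l, 0 < complex.Re l ->
        forall z, is_laplace_transform u l z ->
                  is_laplace_transform (Foo u) l (P l z)].

Definition is_solution (U X : hilbertType R) (S : well_posed_system U X U)
    (Psioo : X -> R -> U) (Foo : (R -> U) -> R -> U) (phi : U -> U)
    (x0 : X) (v : R -> U) (x : R -> X) (y : R -> U) : Prop :=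
  let w := fun s => phi (v s - y s) in
  [/\ {within `[0, +oo[, continuous x},
      L2loc y,
      forall t : R, 0 <= t -> x t = sgT S t x0 + Phi S t (trunc t w) &
      y = (fun s => Psioo x0 s + Foo w s) %[ae mu in halfline]].

End WellPosed.

(* Main.v *)
Require Import Defs.
From HB Require Import structures.
From mathcomp Require Import all_boot all_order all_algebra.
From mathcomp Require Import sesquilinear complex.
From mathcomp Require Import all_classical all_reals all_analysis.
From mathcomp Require Import measurable_realfun.
From mathcomp Require Import ring lra.

Set Implicit Arguments.
Unset Strict Implicit.
Unset Printing Implicit Defensive.

Import Order.TTheory GRing.Theory Num.Theory Num.Def.
Import numFieldNormedType.Exports.

Local Open Scope classical_set_scope.
Local Open Scope ring_scope.
Local Open Scope complex_scope.

(* Truncation of functions, not of numbers. *)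
Local Notation trunc := Defs.trunc.

(** Write [w = phi (v - y)] for the signal fed to the system and
    [f = v - Psioo x0].  The feedback equations say that [w = phi (f - Foo w)],
    and everything else ([y] and the trajectory) is then given by explicit
    formulas.  Two monotonicity facts drive the proof.

    - Passivity with initial state 0 makes [Foo] monotone on every interval:
      the integral over ]0, t[ of Re <d, Foo d> is nonnegative
      ([Foo_monotone]).  Well-posedness makes it bounded on L^2(0, tau)
      ([Foo_bounded]) and it is causal ([Foo_causal]).
    - The hypothesis on [phi] says that the (possibly multivalued) inverse of
      [phi] is strongly monotone with constant [gamma].  Hence, for [r > 0], the
      resolvent [J] of that inverse, which sends [h] to the [w = phi e] such
      that [w + r e = h], is everywhere defined and Lipschitz with constant
      [1 / (1 + r gamma)] ([cocoercive_resolvent]).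

    In terms of [J], the equation [w = phi (f - Foo w)] reads
    [w = J (w - r Foo w + r f)], a forward-backward splitting.  If
    [|Foo d|^2 <= M |d|^2] in L^2(0, tau), monotonicity gives
    [|d - r Foo d|^2 <= (1 + r^2 M) |d|^2]; with [r = gamma / M] the right-hand
    side of the equation is a contraction of L^2(0, tau), whose squared norms
    are contracted by [1 / (1 + r gamma)].  The iterates converge because L^2
    of strongly measurable functions is complete along geometric sequences
    ([L2_geometric_limit]); the solutions on the intervals ]0, n[ agree by
    monotonicity and causality and are glued ([feedback_global]).

    Passivity with input 0 makes the semigroup contractive, and with initial
    state 0 it bounds [Phi] by the energy of the input; together these give the
    continuity of mild trajectories ([mild_state_continuous]).

    For the incremental estimate, the difference of two solutions is itself a
    mild trajectory, with input [w2 - w1] and output [y2 - y1].  Writing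
    [y = v - e] with [w = phi e], the supply rate is
    [2 Re <w2 - w1, v2 - v1> - 2 Re <w2 - w1, e2 - e1>]; Young's inequality
    bounds the first term and cocoercivity the second.  Uniqueness is the case
    of equal data. *)

(** * Real-valued norm and inner product *)

Section HilbertNorm.
Context {R : realType} (U : hilbertType R).
Implicit Types (x y z : U) (a b : R).

Lemma normE x : `|x| = (rnorm x)%:C.
Proof.
have := normr_ge0 x; rewrite /rnorm; case: `|x| => r i /=.
by rewrite lecE /= => /andP[/eqP -> _].
Qed.

Lemma rnorm_ge0 x : 0 <= rnorm x.
Proof. by rewrite -lecR -normE normr_ge0. Qed.

Lemma rnormD x y : rnorm (x + y) <= rnorm x + rnorm y.
Proof. by rewrite -lecR rmorphD /= -!normE ler_normD. Qed.

Lemma rnorm0 : rnorm (0 : U) = 0.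
Proof. by rewrite /rnorm normr0. Qed.

Lemma rnorm_distC x y : rnorm (x - y) = rnorm (y - x).
Proof. by rewrite /rnorm distrC. Qed.

Lemma rnorm0_eq0 x : rnorm x = 0 -> x = 0.
Proof. by move=> h; apply/eqP; rewrite -normr_eq0 normE h. Qed.

Lemma scaleN1E x : (-1 : R)%:C *: x = - x.
Proof. by rewrite rmorphN1 scaleN1r. Qed.

(** The real part of the inner product turns [U] into a real inner product
    space with the same norm, in which cocoercivity and passivity are stated. *)
Definition rdot x y : R := complex.Re (dotp x y).

Lemma rdotxx x : rdot x x = rnorm x ^+ 2.
Proof. by rewrite /rdot dotpE normE -rmorphXn. Qed.

Lemma rdotC x y : rdot x y = rdot y x.
Proof. by rewrite /rdot hermC /= expr0 mul1r; case: (dotp y x). Qed.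

Lemma rdotDl x y z : rdot (x + y) z = rdot x z + rdot y z.
Proof. by rewrite /rdot linearDl raddfD. Qed.

Lemma rdotNl x y : rdot (- x) y = - rdot x y.
Proof. by rewrite /rdot linearNl raddfN. Qed.

Lemma rdotZl a x y : rdot (a%:C *: x) y = a * rdot x y.
Proof.
rewrite /rdot linearZl_LR /=.
by case: (dotp x y) => r i /=; rewrite mul0r subr0.
Qed.

Lemma rdotDr x y z : rdot x (y + z) = rdot x y + rdot x z.
Proof. by rewrite rdotC rdotDl !(rdotC x). Qed.

Lemma rdotNr x y : rdot x (- y) = - rdot x y.
Proof. by rewrite rdotC rdotNl rdotC. Qed.

Lemma rdotZr a x y : rdot x (a%:C *: y) = a * rdot x y.
Proof. by rewrite rdotC rdotZl rdotC. Qed.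

Lemma rdot0l x : rdot 0 x = 0.
Proof. by have := rdotZl 0 0 x; rewrite scaler0 mul0r. Qed.

Definition rdotE := (rdotDl, rdotDr, rdotNl, rdotNr, rdotZl, rdotZr).

Lemma rnormZ a x : rnorm (a%:C *: x) = `|a| * rnorm x.
Proof.
apply/eqP; rewrite -(@eqrXn2 _ 2) ?mulr_ge0 ?rnorm_ge0//; apply/eqP.
by rewrite exprMn -!rdotxx !rdotE real_normK ?num_real // expr2 mulrA.
Qed.

Lemma rnormD2 x y : rnorm (x + y) ^+ 2 = rnorm x ^+ 2 + 2 * rdot x y + rnorm y ^+ 2.
Proof. by rewrite -!rdotxx !rdotE (rdotC y x); ring. Qed.

Lemma rnormB2 x y : rnorm (x - y) ^+ 2 = rnorm x ^+ 2 - 2 * rdot x y + rnorm y ^+ 2.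
Proof. by rewrite -!rdotxx !rdotE (rdotC y x); ring. Qed.

Lemma rnorm_sqrD x y :
  rnorm (x + y) ^+ 2 <= 2 * rnorm x ^+ 2 + 2 * rnorm y ^+ 2.
Proof.
by have := sqr_ge0 (rnorm (x - y)); rewrite rnormB2 rnormD2; lra.
Qed.

(** Expand the square of [a x - y] and divide by [a]. *)
Lemma rdot_Young a x y : 0 < a ->
  2 * rdot x y <= a * rnorm x ^+ 2 + a^-1 * rnorm y ^+ 2.
Proof.
move=> a0; have := sqr_ge0 (rnorm (a%:C *: x - y)).
rewrite rnormB2 rnormZ rdotZl gtr0_norm // exprMn.
have : 0 < a^-1 by rewrite invr_gt0.
move=> ia0 /(mulr_ge0 (ltW ia0)); rewrite mulrDr mulrBr expr2 !mulrA.
rewrite mulVf ?gt_eqF // mul1r [_ * 2]mulrC -[2 / a * a]mulrA mulVf ?gt_eqF // mulr1.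
lra.
Qed.

(** Young's inequality with the optimal weight [a = |y| / |x|]. *)
Lemma rdot_CauchySchwarz x y : rdot x y <= rnorm x * rnorm y.
Proof.
have [/rnorm0_eq0 ->|x0] := eqVneq (rnorm x) 0.
  by rewrite rnorm0 mul0r rdot0l.
have [/rnorm0_eq0 ->|y0] := eqVneq (rnorm y) 0.
  by rewrite rnorm0 mulr0 rdotC rdot0l.
have px : 0 < rnorm x by rewrite lt_neqAle eq_sym x0 rnorm_ge0.
have py : 0 < rnorm y by rewrite lt_neqAle eq_sym y0 rnorm_ge0.
have := @rdot_Young (rnorm y / rnorm x) x y (divr_gt0 py px).
rewrite invf_div.
suff -> : rnorm y / rnorm x * rnorm x ^+ 2 + rnorm x / rnorm y * rnorm y ^+ 2 =
  2 * (rnorm x * rnorm y) by lra.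
by field; rewrite x0 y0.
Qed.

(** The norm of [U] takes values in R[i], so convergence in [U] is tested with
    radii in R[i]; a positive element of R[i] is a positive real. *)
Lemma rnorm_cvgP (T : Type) (F : set_system T) {filF : Filter F} (f : T -> U) x :
  f @ F --> x <-> forall e : R, 0 < e -> \forall t \near F, rnorm (f t - x) < e.
Proof.
split.
  move=> /cvgrPdist_lt h e e0.
  have /h : 0 < e%:C by rewrite ltcR.
  by apply: filterS => t; rewrite normE ltcR rnorm_distC.
move=> h; apply/cvgrPdist_lt => e.
case: e => r i; rewrite ltcE /= => /andP[/eqP -> r0].
apply: filterS (h r r0) => t.
by rewrite normE ltcR rnorm_distC.
Qed.

Lemma rnorm_cvg0P (T : Type) (F : set_system T) {filF : Filter F} (f : T -> U) x :
  f @ F --> x <-> (rnorm (f t - x)) @[t --> F] --> (0 : R).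
Proof.
split=> [/rnorm_cvgP h|h].
  apply/cvgrPdist_lt => e /h; apply: filterS => t.
  by rewrite sub0r normrN ger0_norm ?rnorm_ge0.
apply/rnorm_cvgP => e e0; move/cvgrPdist_lt: h => /(_ e e0); apply: filterS => t.
by rewrite sub0r normrN ger0_norm ?rnorm_ge0.
Qed.

Lemma rnorm_dist x y : `|rnorm x - rnorm y| <= rnorm (x - y).
Proof.
rewrite ler_norml; apply/andP; split.
  by have := rnormD (y - x) x; rewrite subrK rnorm_distC; lra.
by have := rnormD (x - y) y; rewrite subrK; lra.
Qed.

Lemma cvg_rnorm (T : Type) (F : set_system T) {filF : Filter F} (f : T -> U) x :
  f @ F --> x -> (rnorm (f t)) @[t --> F] --> rnorm x.
Proof.
move=> /rnorm_cvgP h; apply/cvgrPdist_lt => e /h; apply: filterS => t.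
by apply: le_lt_trans; rewrite distrC rnorm_dist.
Qed.

Lemma seq_cvg_unique (u : nat -> U) x y : u @ \oo --> x -> u @ \oo --> y -> x = y.
Proof. by move=> /cvg_lim <- // /cvg_lim <-. Qed.

(** The explicit rate is what makes the limit square-integrable in
    [L2_geometric_limit]. *)
Lemma geometric_cvg (u : nat -> U) (A rho : R) : 0 <= rho < 1 ->
  (forall n, rnorm (u n.+1 - u n) <= A * rho ^+ n) ->
  exists2 x : U, u @ \oo --> x & forall n, rnorm (u n - x) <= A * rho ^+ n / (1 - rho).
Proof.
move=> /andP[r0 r1] h.
have rn0 : 0 < 1 - rho by rewrite subr_gt0.
have A0 : 0 <= A.
  by have := h 0; rewrite expr0 mulr1; apply: le_trans; exact: rnorm_ge0.
have tail n m : rnorm (u (n + m)%N - u n) <= A * rho ^+ n / (1 - rho) * (1 - rho ^+ m).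
  elim: m => [|m IH]; first by rewrite addn0 subrr rnorm0 expr0 subrr mulr0.
  rewrite addnS -(subrKA (u (n + m)%N)).
  apply: le_trans (rnormD _ _) _.
  apply: le_trans (lerD (h _) IH) _.
  rewrite exprD exprS le_eqVlt; apply/orP; left; apply/eqP.
  by field; rewrite gt_eqF.
have tail' n m : rnorm (u (n + m)%N - u n) <= A * rho ^+ n / (1 - rho).
  apply: le_trans (tail n m) _; rewrite ler_piMr //.
    by rewrite divr_ge0 ?mulr_ge0 ?exprn_ge0 // ltW.
  by rewrite gerBl exprn_ge0.
have g0 : (fun n => A * rho ^+ n / (1 - rho)) @ \oo --> (0:R).
  rewrite -(mul0r ((1 - rho)^-1)); apply: cvgMl.
  rewrite -(mulr0 A); apply: cvgMr; apply: cvg_expr.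
  by rewrite ger0_norm.
have cu : cvgn u.
  apply/cauchy_cvgP/cauchy_exP => e.
  case: e => e i; rewrite ltcE /= => /andP[/eqP -> e0].
  move/cvgrPdist_lt: g0 => /(_ _ e0) [N _ HN].
  exists (u N); exists N => // m /= Nm.
  rewrite -ball_normE /ball_ /= normE ltcR rnorm_distC -(subnKC Nm).
  apply: le_lt_trans (tail' _ _) _.
  have := HN N (leqnn N); rewrite /= sub0r normrN.
  exact: (le_lt_trans (ler_norm _)).
exists (limn u : U) => [|n]; first exact: cu.
have cn : (fun m => u (n + m)%N - u n) @ \oo --> ((limn u : U) - u n).
  apply: cvgB; last exact: cvg_cst.
  have /(cvg_comp _ _) : (fun m => (n + m)%N) @ \oo --> \oo.
    exact: cvg_addnl.
  by apply; exact: cu.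
rewrite rnorm_distC.
have cr : rnorm (u (n + m)%N - u n) @[m --> \oo] --> rnorm ((limn u : U) - u n).
  exact: cvg_rnorm cn.
rewrite -(cvg_lim _ cr) //; apply: limr_le; first exact: cvgP cr.
by near=> m; exact: tail'.
Unshelve. all: by end_near.
Qed.

End HilbertNorm.

(** * Cocoercive maps and their resolvents *)

Section Resolvent.
Context {R : realType} (U : hilbertType R).
Implicit Types (x y z e : U) (a b : R).

Lemma contraction_fixpoint (T : U -> U) (q : R) : 0 <= q < 1 ->
  (forall x y, rnorm (T x - T y) <= q * rnorm (x - y)) -> exists x, T x = x.
Proof.
move=> /andP[q0 q1] hT; pose u n := iter n T (0 : U).
have hu n : rnorm (u n.+1 - u n) <= rnorm (T 0) * q ^+ n.
  elim: n => [|n IH]; first by rewrite /u /= subr0 expr0 mulr1.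
  rewrite exprS mulrCA; apply: le_trans (hT _ _) _.
  by rewrite ler_wpM2l.
have [|x ux _] := geometric_cvg _ hu; first by rewrite q0.
exists x; apply: (@seq_cvg_unique _ _ (fun n => u n.+1)); last first.
  by move: ux; rewrite -cvg_shiftS.
apply/rnorm_cvgP => e e0; move/rnorm_cvgP: ux => /(_ e e0); apply: filterS => n.
apply: le_lt_trans; apply: le_trans (hT _ _) _.
by rewrite ler_piMl ?rnorm_ge0 // ltW.
Qed.

Variables (phi : U -> U) (gamma : R) (gamma_gt0 : 0 < gamma).
Hypothesis phi_cocoercive : forall e1 e2,
  gamma * rnorm (phi e2 - phi e1) ^+ 2 <= rdot (phi e2 - phi e1) (e2 - e1).

(** Cauchy-Schwarz applied to the cocoercivity inequality. *)
Lemma cocoercive_Lipschitz e1 e2 :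
  rnorm (phi e2 - phi e1) <= gamma^-1 * rnorm (e2 - e1).
Proof.
have [->|d0] := eqVneq (rnorm (phi e2 - phi e1)) 0.
  by rewrite mulr_ge0 ?rnorm_ge0 // invr_ge0 ltW.
have d1 : 0 < rnorm (phi e2 - phi e1) by rewrite lt_neqAle eq_sym d0 rnorm_ge0.
rewrite ler_pdivlMl // -(ler_pM2r d1) -mulrA -expr2.
apply: le_trans (phi_cocoercive _ _) _; rewrite mulrC; exact: rdot_CauchySchwarz.
Qed.

(** For each [h] the equation [phi e + r e = h] is solved by iterating
    [e - s (phi e + r e - h)]: cocoercivity lets the cross term absorb the
    square of the increment of [phi] when [s = 2 gamma (1 - s r)], and what is
    left contracts by [1 - s r].  The Lipschitz bound is the strong
    monotonicity of the inverse of [phi] tested against [h2 - h1]. *)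
Lemma cocoercive_resolvent (r : R) : 0 < r ->
  exists2 J : U -> U, forall h, exists2 e, J h = phi e & J h + r%:C *: e = h &
    forall h1 h2, (1 + r * gamma) * rnorm (J h2 - J h1) <= rnorm (h2 - h1).
Proof.
move=> r0.
suff solve h : exists e, phi e + r%:C *: e = h.
  have [E hE] := choice solve.
  exists (phi \o E) => [h|h1 h2]; first by exists (E h); rewrite /= ?hE.
  rewrite /=; set d := phi (E h2) - phi (E h1).
  have [->|d0] := eqVneq (rnorm d) 0; first by rewrite mulr0 rnorm_ge0.
  have d1 : 0 < rnorm d by rewrite lt_neqAle eq_sym d0 rnorm_ge0.
  rewrite -(ler_pM2r d1); apply: le_trans (rdot_CauchySchwarz _ _).
  rewrite -[in leRHS](hE h2) -[in leRHS](hE h1).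
  rewrite opprD addrACA -/d -scalerBr rdotDl rdotxx rdotZl rdotC.
  have := phi_cocoercive (E h1) (E h2); rewrite -/d => /(ler_wpM2l (ltW r0)).
  by lra.
have D0 : 0 < 1 + 2 * gamma * r by rewrite ltr_wpDr // !mulr_ge0 // ltW.
(* The solution of [s = 2 gamma (1 - s r)]. *)
pose s := 2 * gamma / (1 + 2 * gamma * r).
have s0 : 0 < s by rewrite divr_gt0 // mulr_gt0.
have sr : 1 - s * r = (1 + 2 * gamma * r)^-1 by rewrite /s; field; rewrite gt_eqF.
have [||e he] := @contraction_fixpoint
  (fun e => e - s%:C *: (phi e + r%:C *: e - h)) (1 - s * r).
- rewrite sr invr_ge0 ltW //= invf_lt1 //; rewrite ltrDl !mulr_gt0 //.
- move=> x y; set d := phi x - phi y.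
  have -> : x - s%:C *: (phi x + r%:C *: x - h) - (y - s%:C *: (phi y + r%:C *: y - h))
     = (1 - s * r)%:C *: (x - y) - s%:C *: d.
    rewrite (_ : x - _ - _ = x - y -
        s%:C *: ((phi x + r%:C *: x - h) - (phi y + r%:C *: y - h))); last first.
      by rewrite [in RHS]scalerBr !opprD !opprK addrACA.
    rewrite opprB addrA subrK opprD addrACA -/d -scalerBr.
    have -> : (1 - s * r)%:C = 1 - s%:C * r%:C by rewrite -rmorphM -rmorphB.
    by rewrite scalerBl scale1r scalerDr scalerA opprD addrA addrAC.
  have q0 : 0 <= 1 - s * r by rewrite sr invr_ge0 ltW.
  rewrite -(@ler_pXn2r _ 2) ?nnegrE ?mulr_ge0 ?rnorm_ge0 //.
  rewrite rnormB2 !rnormZ rdotZl rdotZr !exprMn !real_normK ?num_real //.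
  rewrite rdotC.
  have := phi_cocoercive y x; rewrite -/d => h1.
  have se : s = 2 * (1 - s * r) * gamma by rewrite sr /s; field; rewrite gt_eqF.
  have : 2 * ((1 - s * r) * (s * rdot d (x - y))) >= s ^+ 2 * rnorm d ^+ 2.
    have := ler_wpM2l (mulr_ge0 (mulr_ge0 (ler0n R 2) q0) (ltW s0)) h1.
    have -> : s ^+ 2 * rnorm d ^+ 2 = 2 * (1 - s * r) * s * (gamma * rnorm d ^+ 2).
      by rewrite expr2 {2}se; ring.
    by rewrite -!mulrA.
  by lra.
exists e; apply/eqP; rewrite -subr_eq0.
move/eqP: he; rewrite -subr_eq0 addrAC subrr sub0r oppr_eq0 scaler_eq0.
by case/orP => // /eqP; case=> /eqP; rewrite gt_eqF.
Qed.

End Resolvent.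

(** * Strongly measurable functions *)

Section StrongMeasurability.
Context {R : realType}.
Implicit Types (U V W : hilbertType R) (D : set (measurableTypeR R)).

(** Each fibre of the composite is a finite union of intersections of fibres. *)
Lemma simple_comp2 U V W (F : U -> V -> W) g h :
  simple_function g -> simple_function h ->
  simple_function (fun t : R => F (g t) (h t)).
Proof.
move=> [fg mg] [fh mh]; split.
  apply: (@sub_finite_set _ _ ((fun p => F p.1 p.2) @` (range g `*` range h))).
    by move=> _ [t _ <-]; exists (g t, h t) => //; split; exists t.
  by apply: finite_image; exact: finite_setX.
move=> z.
have -> : (fun t => F (g t) (h t)) @^-1` [set z] =
    \bigcup_(p in (range g `*` range h) `&` [set p | F p.1 p.2 = z])
      (g @^-1` [set p.1] `&` h @^-1` [set p.2]).
  apply/seteqP; split => t /=.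
    by move=> tz; exists (g t, h t) => //; split => //; split; exists t.
  by move=> [[a b] [_ /= <-]] [/= -> ->].
apply: fin_bigcup_measurable.
  by apply: finite_setIl; exact: finite_setX.
by move=> [a b] _; exact: measurableI.
Qed.

Lemma simple_cst U (c : U) : simple_function (fun _ : R => c).
Proof.
split; first by apply: (@sub_finite_set _ _ [set c]) => [_ [t _ <-]|].
by move=> z; rewrite preimage_cst; case: ifP.
Qed.

Lemma simple_patch U (A : set R) (g h : R -> U) : measurable A ->
  simple_function g -> simple_function h ->
  simple_function (fun t => if t \in A then g t else h t).
Proof.
move=> mA [fg mg] [fh mh]; split.
  apply: (@sub_finite_set _ _ (range g `|` range h)).
    by move=> _ [t _ <-]; case: ifP => _; [left|right]; exists t.
  by rewrite finite_setU.
move=> z.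
have -> : (fun t => if t \in A then g t else h t) @^-1` [set z] =
    (A `&` g @^-1` [set z]) `|` (~` A `&` h @^-1` [set z]).
  apply/seteqP; split => t /=.
    by case: ifPn; rewrite ?notin_setE ?inE; [left|right].
  by move=> [[tA gt]|[tA ht]]; [rewrite mem_set|rewrite memNset].
by apply: measurableU; apply: measurableI => //; exact: measurableC.
Qed.

Lemma sm_subset U D E (f : R -> U) : E `<=` D ->
  strongly_measurable D f -> strongly_measurable E f.
Proof. by move=> ED [g sg gf]; exists g => // t /ED; exact: gf. Qed.

Lemma eq_sm U D (f h : R -> U) : (forall t, D t -> f t = h t) ->
  strongly_measurable D f -> strongly_measurable D h.
Proof. by move=> fh [g sg gf]; exists g => // t Dt; rewrite -fh //; exact: gf. Qed.

Lemma sm_cst U D (c : U) : strongly_measurable D (fun=> c).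
Proof.
by exists (fun _ _ => c) => [n|t _]; [exact: simple_cst|exact: cvg_cst].
Qed.

Lemma sm_patch U A D (f h : R -> U) : measurable A ->
  strongly_measurable (D `&` A) f -> strongly_measurable (D `&` ~` A) h ->
  strongly_measurable D (fun t => if t \in A then f t else h t).
Proof.
move=> mA [g sg gf] [k sk kh].
exists (fun n t => if t \in A then g n t else k n t).
  by move=> n; exact: simple_patch.
move=> t Dt; case: ifPn; rewrite ?notin_setE ?inE => tA.
  by apply: gf; split.
by apply: kh; split.
Qed.

Lemma sm_comp2 U V W (F : U -> V -> W) D f h :
  (forall (a : nat -> U) (b : nat -> V) x y, a @ \oo --> x -> b @ \oo --> y ->
     F (a n) (b n) @[n --> \oo] --> F x y) ->
  strongly_measurable D f -> strongly_measurable D h ->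
  strongly_measurable D (fun t => F (f t) (h t)).
Proof.
move=> cF [g sg gf] [k sk kh]; exists (fun n t => F (g n t) (k n t)).
  by move=> n; exact: simple_comp2.
by move=> t Dt; apply: cF; [exact: gf|exact: kh].
Qed.

Lemma sm_add U D (f h : R -> U) : strongly_measurable D f ->
  strongly_measurable D h -> strongly_measurable D (fun t => f t + h t).
Proof. by apply: sm_comp2 => a b x y; exact: cvgD. Qed.

Lemma sm_scale U D (c : R[i]) (f : R -> U) : strongly_measurable D f ->
  strongly_measurable D (fun t => c *: f t).
Proof.
move=> sf; apply: (@sm_comp2 U U U (fun x _ => c *: x) D f f) => // a b x y ax _.
exact: cvgZr.
Qed.

Lemma sm_comp U V D (F : U -> V) (f : R -> U) :
  (forall (a : nat -> U) x, a @ \oo --> x -> F (a n) @[n --> \oo] --> F x) ->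
  strongly_measurable D f -> strongly_measurable D (fun t => F (f t)).
Proof.
move=> cF sf; apply: (@sm_comp2 U U V (fun x _ => F x) D f f) => // a b x y ax _.
exact: cF.
Qed.

Lemma simple_rnorm U (g : R -> U) : simple_function g ->
  measurable_fun (setT : set (measurableTypeR R)) (fun t => rnorm (g t)).
Proof.
move=> [fg mg] _ Y mY; rewrite setTI.
have -> : (fun t => rnorm (g t)) @^-1` Y =
    \bigcup_(z in range g `&` [set z | Y (rnorm z)]) (g @^-1` [set z]).
  apply/seteqP; split => t /=.
    by move=> tz; exists (g t) => //; split => //; exists t.
  by move=> [a [_ /= Ya]] ->.
apply: fin_bigcup_measurable; first by apply: finite_setIl.
by move=> z _; exact: mg.
Qed.

Lemma sm_rnorm U D (f : R -> U) : measurable D -> strongly_measurable D f ->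
  measurable_fun D (fun t => rnorm (f t)).
Proof.
move=> mD [g sg gf]; apply: (@measurable_fun_cvg _ _ _ D (fun n t => rnorm (g n t))).
- by move=> n; apply: measurable_funTS; exact: simple_rnorm.
- by move=> t Dt; apply: cvg_rnorm; exact: gf.
Qed.

(** Polarization reduces the measurability of the inner product to that of
    norms. *)
Lemma sm_rdot U D (f h : R -> U) : measurable D -> strongly_measurable D f ->
  strongly_measurable D h -> measurable_fun D (fun t => rdot (f t) (h t)).
Proof.
move=> mD sf sh.
have -> : (fun t => rdot (f t) (h t)) = (fun t => 2^-1 *
   (rnorm (f t + h t) ^+ 2 - rnorm (f t) ^+ 2 - rnorm (h t) ^+ 2)).
  by apply/funext => t; rewrite rnormD2; field.
apply: measurable_funM => //; apply: measurable_funB; first apply: measurable_funB.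
all: apply: measurable_funX; apply: sm_rnorm => //.
exact: sm_add.
Qed.

End StrongMeasurability.

Section StrongLimit.
Context {R : realType} (U : hilbertType R).
Implicit Types (D : set (measurableTypeR R)).

(** The values of all the approximating simple functions form a countable set. *)
Lemma sm_separable D (f : R -> U) : strongly_measurable D f ->
  exists z : nat -> U, forall t, D t -> forall e : R, 0 < e ->
    exists k, rnorm (f t - z k) < e.
Proof.
move=> [g sg gf].
have /choice [s hs] n : exists s : seq U, range (g n) = [set` s].
  by have [/finite_seqP] := sg n.
exists (fun k => if unpickle k is Some (n, j) then nth 0 (s n) j else 0).
move=> t Dt e e0; have /rnorm_cvgP/(_ e e0) [n _ /(_ n (leqnn n)) /= h] := gf t Dt.
have gs : g n t \in s n.
  have : [set` s n] (g n t) by rewrite -hs; exists t.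
  by [].
exists (pickle (n, index (g n t) (s n))).
by rewrite pickleK nth_index // rnorm_distC.
Qed.

(** Approximate [f t] by the closest to it of 0 and the first [n] points of the
    dense sequence; measurability of the distances makes the regions where
    a given point is chosen measurable. *)
Lemma sm_of_separable D (f : R -> U) : measurable D ->
  (forall z, measurable_fun D (fun t => rnorm (f t - z))) ->
  (exists z : nat -> U, forall t, D t -> forall e : R, 0 < e ->
    exists k, rnorm (f t - z k) < e) ->
  strongly_measurable D f.
Proof.
move=> mD mf [z hz].
pose fix G n (t : R) {struct n} : U := if n is k.+1 then
  (if t \in D `&` [set t | rnorm (f t - z k) < rnorm (f t - G k t)]
   then z k else G k t) else 0.
have GS n t : G n.+1 t =
  if t \in D `&` [set t | rnorm (f t - z n) < rnorm (f t - G n t)]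
   then z n else G n t by [].
have sG n : simple_function (G n) /\
    measurable_fun D (fun t => rnorm (f t - G n t)).
  elim: n => [|n [sGn mGn]].
    by split; [exact: (@simple_cst R U 0)|exact: mf].
  set A := D `&` [set t | rnorm (f t - z n) < rnorm (f t - G n t)].
  have mA : measurable A.
    have := measurable_fun_ltr (mf (z n)) mGn.
    by move=> /(_ mD [set true]); rewrite (_ : _ @^-1` _ =
     [set t | rnorm (f t - z n) < rnorm (f t - G n t)]) //; exact.
  split; first by apply: (@simple_patch _ _ _ (fun=> z n)) => //; exact: simple_cst.
  apply: (@eq_measurable_fun _ _ _ _ _
    (fun t => Order.min (rnorm (f t - z n)) (rnorm (f t - G n t)))); last first.
    exact: (measurable_minr (mf (z n)) mGn).
  move=> t; rewrite inE => Dt; rewrite GS -/A /Order.min.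
  case: ifPn => h; first by rewrite mem_set.
  by rewrite memNset // => -[_ /=]; apply/negP.
exists G => [n|t Dt]; first by have [] := sG n.
apply/rnorm_cvgP => e e0; have [k hk] := hz t Dt e e0.
exists k.+1 => // m /=; rewrite rnorm_distC.
elim: m => // m IH; rewrite ltnS leq_eqVlt => /orP[/eqP <-|km].
  rewrite GS; case: ifPn => //; rewrite notin_setE => h.
  apply: le_lt_trans hk; rewrite leNgt; apply/negP => h'.
  by apply: h.
rewrite GS; case: ifPn => [|_]; last exact: IH.
rewrite inE => -[_ /=] /lt_trans; apply; exact: IH.
Qed.

(** Near-values and distance functions both pass to pointwise limits, so the
    criterion [sm_of_separable] applies; a diagonal choice in the
    approximating simple functions need not converge pointwise. *)
Lemma sm_lim D (F : nat -> R -> U) (f : R -> U) : measurable D ->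
  (forall n, strongly_measurable D (F n)) ->
  (forall t, D t -> F n t @[n --> \oo] --> f t) -> strongly_measurable D f.
Proof.
move=> mD sF cF; apply: sm_of_separable => // [z|].
  apply: (@measurable_fun_cvg _ _ _ D (fun n t => rnorm (F n t - z))).
    move=> n; apply: sm_rnorm => //; apply: sm_add => //; exact: sm_cst.
  move=> t Dt; apply: cvg_rnorm; apply: cvgB; [exact: cF|exact: cvg_cst].
have /choice [z hz] n := sm_separable (sF n).
exists (fun k => if unpickle k is Some (n, j) then z n j else 0) => t Dt e e0.
have e20 : 0 < e / 2 by rewrite divr_gt0.
have /rnorm_cvgP/(_ _ e20) [n _ /(_ n (leqnn n)) /= h] := cF t Dt.
have [j hj] := hz n t Dt _ e20.
exists (pickle (n, j)); rewrite pickleK.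
have := rnormD (f t - F n t) (F n t - z n j).
by rewrite subrKA rnorm_distC; lra.
Qed.

End StrongLimit.

(** * Square-integrable functions *)

Section SquareIntegrable.
Context {R : realType} (U : hilbertType R).
Local Notation mu := (@lebesgue_measure R).
Implicit Types (D E : set (measurableTypeR R)) (f g h : R -> U).

(** The squared norm of L^2(D; U). *)
Definition energy D f : R := \int[mu]_(t in D) (rnorm (f t) ^+ 2).

Lemma energy_ge0 D f : 0 <= energy D f.
Proof. by apply: Rintegral_ge0 => t _; exact: sqr_ge0. Qed.

Lemma sqr_L2norm D f : L2norm D f ^+ 2 = energy D f.
Proof. by rewrite sqr_sqrtr // energy_ge0. Qed.

Lemma sm_sqr D f : measurable D -> strongly_measurable D f ->
  measurable_fun D (fun t => rnorm (f t) ^+ 2).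
Proof. by move=> mD sf; apply: measurable_funX; exact: sm_rnorm. Qed.

Lemma L2_integrable D f : measurable D -> L2 D f ->
  mu.-integrable D (EFin \o (fun t => rnorm (f t) ^+ 2)).
Proof.
move=> mD [sf fi]; apply/integrableP; split.
  by apply/measurable_EFinP; exact: sm_sqr.
apply: le_lt_trans fi; rewrite le_eqVlt; apply/orP; left; apply/eqP.
by apply: eq_integral => t _; rewrite /= ger0_norm // sqr_ge0.
Qed.

Lemma energyE D f : measurable D -> L2 D f ->
  (\int[mu]_(t in D) (rnorm (f t) ^+ 2)%:E)%E = (energy D f)%:E.
Proof.
move=> mD Lf; rewrite /energy /Rintegral fineK //.
exact: integrable_fin_num (L2_integrable mD Lf).
Qed.

Lemma L2_dominated D f (g : R -> R) : measurable D -> strongly_measurable D f ->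
  mu.-integrable D (EFin \o g) -> (forall t, D t -> rnorm (f t) ^+ 2 <= g t) ->
  L2 D f.
Proof.
move=> mD sf ig fg; split => //.
have := integrable_lty mD ig; apply: le_lt_trans; apply: ge0_le_integral => //.
- by move=> t _; rewrite lee_fin sqr_ge0.
- by apply/measurable_EFinP; exact: sm_sqr.
- by case/integrableP: ig.
Qed.

Lemma L2_subset D E f : measurable D -> measurable E -> E `<=` D ->
  L2 D f -> L2 E f.
Proof.
move=> mD mE ED Lf; apply: (@L2_dominated _ _ (fun t => rnorm (f t) ^+ 2)) => //.
  by case: Lf => sf _; exact: sm_subset sf.
by apply: integrableS (L2_integrable mD Lf).
Qed.

Lemma eq_L2 D f h : measurable D -> (forall t, D t -> f t = h t) -> L2 D f -> L2 D h.
Proof.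
move=> mD fh Lf; apply: (@L2_dominated _ _ (fun t => rnorm (f t) ^+ 2)) => //.
- by case: Lf => sf _; exact: eq_sm sf.
- exact: L2_integrable.
- by move=> t /fh ->.
Qed.

Lemma integrableRD D (a b : R -> R) : measurable D ->
  mu.-integrable D (EFin \o a) -> mu.-integrable D (EFin \o b) ->
  mu.-integrable D (EFin \o (fun t => a t + b t)).
Proof. by move=> mD ia ib; have := integrableD mD ia ib. Qed.

Lemma integrableRZ D (a : R -> R) (k : R) : measurable D ->
  mu.-integrable D (EFin \o a) -> mu.-integrable D (EFin \o (fun t => k * a t)).
Proof. by move=> mD ia; have := integrableZl mD k ia. Qed.

Lemma L2_add D f h : measurable D -> L2 D f -> L2 D h ->
  L2 D (fun t => f t + h t).
Proof.
move=> mD Lf Lh; apply: (@L2_dominated _ _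
  (fun t => 2 * rnorm (f t) ^+ 2 + 2 * rnorm (h t) ^+ 2)) => //.
- by case: Lf; case: Lh => ? _ ? _; exact: sm_add.
- exact: (integrableRD mD (integrableRZ _ mD (L2_integrable mD Lf))
    (integrableRZ _ mD (L2_integrable mD Lh))).
- by move=> t _; exact: rnorm_sqrD.
Qed.

Lemma L2_scale D (a : R) f : measurable D -> L2 D f -> L2 D (fun t => a%:C *: f t).
Proof.
move=> mD Lf; apply: (@L2_dominated _ _ (fun t => a ^+ 2 * rnorm (f t) ^+ 2)) => //.
- by apply: sm_scale; case: Lf.
- by apply: integrableRZ => //; exact: L2_integrable.
- by move=> t _; rewrite rnormZ exprMn real_normK ?num_real.
Qed.

Lemma L2_opp D f : measurable D -> L2 D f -> L2 D (fun t => - f t).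
Proof.
move=> mD /(L2_scale (-1) mD); apply: eq_L2 => // t _.
by rewrite rmorphN1 scaleN1r.
Qed.

Lemma L2_sub D f h : measurable D -> L2 D f -> L2 D h ->
  L2 D (fun t => f t - h t).
Proof. by move=> mD Lf Lh; apply: L2_add => //; exact: L2_opp. Qed.

Lemma L2_cst D (c : U) : measurable D -> (mu D < +oo)%E -> L2 D (fun=> c).
Proof.
move=> mD Doo; split; first exact: sm_cst.
rewrite integral_cst //= lte_mul_pinfty // ?lee_fin ?sqr_ge0 //.
Qed.

Lemma L2_0 D : measurable D -> L2 D (fun=> 0 : U).
Proof.
move=> mD; split; first exact: sm_cst.
by rewrite integral0_eq ?ltry // => t _; rewrite rnorm0 expr0n.
Qed.

Lemma rdot_integrable D f h : measurable D -> L2 D f -> L2 D h ->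
  mu.-integrable D (EFin \o (fun t => rdot (f t) (h t))).
Proof.
move=> mD Lf Lh.
have iD := integrableRD mD (L2_integrable mD Lf) (L2_integrable mD Lh).
have iN := integrableRD mD (L2_integrable mD (L2_add mD Lf Lh))
  (integrableRZ (-1) mD iD).
apply: (eq_integrable mD _ _ _ (integrableRZ 2^-1 mD iN)) => t _ /=.
by rewrite rnormD2; congr (_%:E); field.
Qed.

Lemma le_energy D f h : measurable D -> L2 D f -> L2 D h ->
  (forall t, D t -> rnorm (f t) <= rnorm (h t)) -> energy D f <= energy D h.
Proof.
move=> mD Lf Lh fh; apply: le_Rintegral => //; [exact: L2_integrable..|].
by move=> t /fh ?; rewrite lerXn2r ?nnegrE ?rnorm_ge0.
Qed.

Lemma energyD_le D f h : measurable D -> L2 D f -> L2 D h ->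
  energy D (fun t => f t + h t) <= 2 * energy D f + 2 * energy D h.
Proof.
move=> mD Lf Lh; have If := L2_integrable mD Lf; have Ih := L2_integrable mD Lh.
rewrite -!RintegralZl // -RintegralD //; try exact: integrableRZ.
apply: le_Rintegral => //.
- exact: L2_integrable (L2_add mD Lf Lh).
- by apply: integrableRD => //; exact: integrableRZ.
- by move=> t _; exact: rnorm_sqrD.
Qed.

Lemma energyZ D (a : R) f : measurable D -> L2 D f ->
  energy D (fun t => a%:C *: f t) = a ^+ 2 * energy D f.
Proof.
move=> mD Lf; rewrite -RintegralZl //; last exact: L2_integrable.
by apply: eq_Rintegral => t _ /=; rewrite rnormZ exprMn real_normK ?num_real.
Qed.

Lemma energy_distC D f h :
  energy D (fun t => f t - h t) = energy D (fun t => h t - f t).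
Proof. by apply: eq_Rintegral => t _ /=; rewrite rnorm_distC. Qed.

(** Expand the square under the integral. *)
Lemma energyBZ D (r : R) (u v : R -> U) :
  measurable D -> L2 D u -> L2 D v ->
  energy D (fun t => u t - r%:C *: v t) = energy D u
    - 2 * r * \int[mu]_(t in D) rdot (u t) (v t) + r ^+ 2 * energy D v.
Proof.
move=> mD Lu Lv.
have iu := L2_integrable mD Lu; have iv := L2_integrable mD Lv.
have ir := rdot_integrable mD Lu Lv.
rewrite -mulNr -!RintegralZl // -!RintegralD //.
- apply: eq_Rintegral => t _ /=; rewrite rnormB2 rdotZr rnormZ exprMn.
  by rewrite real_normK ?num_real //; ring.
- exact: (integrableRD mD iu (integrableRZ _ mD ir)).
- exact: (integrableRZ _ mD iv).
- exact: (integrableRZ _ mD ir).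
Qed.

Lemma energy_subset D E f : measurable D -> measurable E -> E `<=` D ->
  L2 D f -> energy E f <= energy D f.
Proof.
move=> mD mE ED Lf; rewrite -lee_fin -!energyE //; last exact: L2_subset Lf.
apply: ge0_subset_integral => //.
  by apply/measurable_EFinP; case: Lf => ? _; exact: sm_sqr.
by move=> t _; rewrite lee_fin sqr_ge0.
Qed.

Lemma ae_eq_Rintegral D (a b : R -> R) : measurable D -> measurable_fun D a ->
  measurable_fun D b -> a = b %[ae mu in D] ->
  \int[mu]_(t in D) a t = \int[mu]_(t in D) b t.
Proof.
move=> mD ma mb ab; rewrite /Rintegral; congr fine.
apply: ae_eq_integral => //; [exact/measurable_EFinP..|].
by apply: filterS ab => t h /h ->.
Qed.

Lemma ae_eq_energy D f h : measurable D -> strongly_measurable D f ->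
  strongly_measurable D h -> f = h %[ae mu in D] -> energy D f = energy D h.
Proof.
move=> mD sf sh fh; apply: ae_eq_Rintegral => //; [exact: sm_sqr..|].
by apply: filterS fh => t e /e ->.
Qed.

Lemma energy_eq0 D f : measurable D -> L2 D f -> energy D f = 0 ->
  f = (fun=> 0) %[ae mu in D].
Proof.
move=> mD Lf e0; have [sf _] := Lf.
have : (\int[mu]_(t in D) `|(rnorm (f t) ^+ 2)%:E| = 0)%E.
  rewrite -[RHS](congr1 EFin e0) -energyE //; apply: eq_integral => t _.
  by rewrite /= ger0_norm // sqr_ge0.
move/(ae_eq_integral_abs mu mD _).1 => /(_ _)[].
  by apply/measurable_EFinP; exact: sm_sqr.
move=> N [mN N0 h]; exists N; split=> //; apply: subset_trans h => t.
apply: contra_not => h Dt; have [/eqP] := h Dt.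
by rewrite sqrf_eq0 => /eqP /rnorm0_eq0.
Qed.

Lemma eq0_energy D f : measurable D -> strongly_measurable D f ->
  f = (fun=> 0) %[ae mu in D] -> energy D f = 0.
Proof.
move=> mD sf f0; rewrite (ae_eq_energy mD sf (sm_cst D (0:U)) f0).
by rewrite /energy /Rintegral integral0_eq // => t _; rewrite rnorm0 expr0n.
Qed.

End SquareIntegrable.

(** * Completeness of L^2 along geometric sequences *)

Section Completeness.
Context {R : realType} (U : hilbertType R).
Local Notation mu := (@lebesgue_measure R).
Implicit Types (D : set (measurableTypeR R)).

(** The partial sums are at most [A / (1 - q) * (1 - q ^ n)]. *)
Lemma nneseries_geometric_lty (a : nat -> R) (A q : R) : 0 <= q < 1 ->
  (forall n, 0 <= a n <= A * q ^+ n) -> (\sum_(n <oo) (a n)%:E < +oo)%E.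
Proof.
move=> /andP[q0 q1] ha.
have q1' : 0 < 1 - q by rewrite subr_gt0.
have A0 : 0 <= A.
  by have /andP[a0 h] := ha 0; rewrite expr0 mulr1 in h; exact: le_trans h.
have partial n : (\sum_(0 <= i < n) (a i)%:E <= (A / (1 - q) * (1 - q ^+ n))%:E)%E.
  elim: n => [|n IH]; first by rewrite big_nil expr0 subrr mulr0.
  rewrite big_nat_recr //=; apply: le_trans (leeD IH (_ : _ <= (A * q ^+ n)%:E)%E) _.
    by rewrite lee_fin; case/andP: (ha n).
  rewrite -EFinD lee_fin exprS le_eqVlt; apply/orP; left; apply/eqP.
  by field; rewrite gt_eqF.
apply: (@le_lt_trans _ _ (A / (1 - q))%:E); last exact: ltry.
apply: lime_le.
  by apply: is_cvg_nneseries => n _ _; rewrite lee_fin; case/andP: (ha n).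
apply: nearW => n; apply: le_trans (partial n) _; rewrite lee_fin ler_piMr //.
  by rewrite divr_ge0 // ltW.
by rewrite gerBl exprn_ge0.
Qed.

(** Choose [p] strictly between [kappa] and 1.  The sum [G] of the series
    [p ^ -n |w (n+1) - w n|^2] has finite integral, so it is finite almost
    everywhere, and there the increments of [w n t] are at most
    [sqrt (G t) * sqrt p ^ n].  Hence [w n t] converges pointwise and
    [|w n - v|^2] is dominated by a multiple of [p ^ n * G]. *)
Lemma L2_geometric_limit D (w : nat -> R -> U) (A kappa : R) :
  (measurable D) -> 0 <= kappa < 1 -> (forall n, L2 D (w n)) ->
  (forall n, energy D (fun t => w n.+1 t - w n t) <= A * kappa ^+ n) ->
  exists2 v, L2 D v & energy D (fun t => w n t - v t) @[n --> \oo] --> (0 : R).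
Proof.
move=> mD /andP[k0 k1] Lw hw.
pose p := (kappa + 1) / 2; pose rho := Num.sqrt p.
have p0 : 0 < p by rewrite divr_gt0 // ltr_wpDl.
have kp : kappa < p by rewrite /p; lra.
have p1 : p < 1 by rewrite /p; lra.
have rho0 : 0 < rho by rewrite sqrtr_gt0.
have rhop : rho ^+ 2 = p by rewrite sqr_sqrtr // ltW.
have rho1 : rho < 1.
  by rewrite -(@ltr_pXn2r _ 2) ?nnegrE ?ler01 ?(ltW rho0) // rhop expr1n.
clearbody rho; clearbody p.
pose d n t := w n.+1 t - w n t.
have Ld n : L2 D (d n) by apply: L2_sub.
pose a n t := p ^- n * rnorm (d n t) ^+ 2.
have a0 n t : 0 <= a n t by rewrite /a mulr_ge0 ?sqr_ge0 ?invr_ge0 ?exprn_ge0 // ltW.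
have ma n : measurable_fun D (fun t => (a n t)%:E).
  have [sd _] := Ld n.
  apply/measurable_EFinP; apply: measurable_funM => //; exact: (sm_sqr mD sd).
pose G t := (\sum_(n <oo) (a n t)%:E)%E.
have G0 t : (0 <= G t)%E by apply: nneseries_ge0 => n _ _; rewrite lee_fin.
have mG : measurable_fun D G.
  apply: (@ge0_emeasurable_sum _ _ _ D (fun n t => (a n t)%:E) xpredT) => [k t _ _|k _].
    by rewrite lee_fin.
  exact: ma.
have iG : mu.-integrable D G.
  apply/integrableP; split=> //.
  under eq_integral do rewrite gee0_abs //.
  rewrite integral_nneseries //; last by move=> n t _; rewrite lee_fin.
  have en n : (\int[mu]_(t in D) (a n t)%:E = (p ^- n * energy D (d n))%:E)%E.
    rewrite EFinM -energyE // -ge0_integralZl_EFin //.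
    - by move=> t _; rewrite lee_fin sqr_ge0.
    - by apply/measurable_EFinP; case: (Ld n) => sd _; exact: (sm_sqr mD sd).
    - by rewrite invr_ge0 exprn_ge0 // ltW.
  rewrite (eq_eseriesr (fun n _ => en n)).
  apply: (@nneseries_geometric_lty _ A (kappa / p)).
    by rewrite divr_ge0 ?(ltW p0) //= ltr_pdivrMr // mul1r.
  move=> n; rewrite mulr_ge0 ?energy_ge0 ?invr_ge0 ?exprn_ge0 ?(ltW p0) //=.
  by rewrite [(kappa / p) ^+ n]exprMn [p^-1 ^+ n]exprVn mulrC mulrA ler_wpM2r //
    ?hw // invr_ge0 exprn_ge0 // ltW.
have [N [mN N0 GN]] := integrable_ae mD iG.
(* [g] is real-valued everywhere: it is 0 where [G] is infinite, inside the
   null set [N]. *)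
pose g t := fine (G t).
have g0 t : 0 <= g t by apply: fine_ge0; exact: G0.
have ig : mu.-integrable D (EFin \o g).
  apply: (le_integrable mD _ _ iG).
    apply/measurable_EFinP; apply: (measurableT_comp _ mG).
    exact: fine_measurable.
  move=> t Dt; rewrite (gee0_abs (G0 t)) gee0_abs ?lee_fin //.
  by rewrite /g /=; move: (G0 t); case: (G t) => //= _; exact: leey.
pose v t : U := if t \in N then 0 else lim (w n t @[n --> \oo]).
(* Both [w' n] and [v] are set to 0 on [N], so that the domination below holds
   at every point. *)
pose w' n t : U := if t \in N then 0 else w n t.
have sw' n : strongly_measurable D (w' n).
  apply: (@sm_patch _ _ N D (fun=> 0)) => //; first exact: sm_cst.
  by case: (Lw n) => sw _; apply: sm_subset sw => t [].
have cvw t : D t -> t \notin N -> (w n t @[n --> \oo] --> v t) /\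
    (forall n, rnorm (w n t - v t) <= Num.sqrt (g t) * rho ^+ n / (1 - rho)).
  move=> Dt tN.
  have Gfin : G t \is a fin_num.
    apply: contrapT => h; move: tN; rewrite notin_setE; apply; apply: GN.
    by move=> /= /(_ Dt).
  have ag k : a k t <= g t.
    rewrite -lee_fin /g fineK //.
    apply: le_trans (nneseries_lim_ge k.+1 _); last by move=> *; rewrite lee_fin.
    rewrite big_nat_recr //= -[leLHS]add0e leeD //.
    by apply: sume_ge0 => *; rewrite lee_fin.
  have [||x wx hx] := @geometric_cvg _ _ (fun n => w n t) (Num.sqrt (g t)) rho.
  - by rewrite (ltW rho0).
  - move=> k; rewrite -(@ler_pXn2r _ 2) ?nnegrE ?rnorm_ge0 ?mulr_ge0
      ?sqrtr_ge0 ?exprn_ge0 ?(ltW rho0) //.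
    rewrite exprMn sqr_sqrtr // -exprM mulnC exprM rhop.
    have := ag k; rewrite /a mulrC ler_pdivrMr ?exprn_gt0 //.
  - have -> : v t = x by rewrite /v (negbTE tN); exact: cvg_lim wx.
    by split.
have sv : strongly_measurable D v.
  apply: (@sm_lim _ _ _ w') => // t Dt; rewrite /w'.
  have [tN|tN] := boolP (t \in N).
    by rewrite /v tN; exact: cvg_cst.
  by have [] := cvw t Dt tN.
have bnd n t : D t -> rnorm (w' n t - v t) ^+ 2 <= p ^+ n / (1 - rho) ^+ 2 * g t.
  move=> Dt; rewrite /w'; case: ifPn => tN.
    rewrite /v tN subrr rnorm0 expr0n /= mulr_ge0 // divr_ge0 ?sqr_ge0 ?exprn_ge0 //.
    exact: ltW.
  have [_ /(_ n)] := cvw t Dt tN.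
  rewrite -(@ler_pXn2r _ 2) ?nnegrE ?rnorm_ge0 // ?divr_ge0 ?mulr_ge0
    ?sqrtr_ge0 ?exprn_ge0 ?subr_ge0 ?(ltW rho0) ?(ltW rho1) //.
  rewrite !exprMn sqr_sqrtr // exprVn -exprM mulnC exprM rhop => h.
  by apply: le_trans h _; rewrite le_eqVlt; apply/orP; left; apply/eqP; ring.
have ib n : mu.-integrable D (EFin \o (fun t => p ^+ n / (1 - rho) ^+ 2 * g t)).
  exact: (integrableRZ _ mD ig).
have swv n : strongly_measurable D (fun t => w' n t - v t).
  have := sm_add (sw' n) (sm_scale (-1) sv); apply: eq_sm => t _.
  by rewrite scaleN1r.
have Lwv n : L2 D (fun t => w' n t - v t) by apply: L2_dominated (ib n) (bnd n).
have Lw' n : L2 D (w' n).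
  apply: L2_dominated (L2_integrable mD (Lw n)) _ => // t Dt.
  by rewrite /w'; case: ifP => _ //; rewrite rnorm0 expr0n sqr_ge0.
have Lv : L2 D v.
  have := L2_sub mD (Lw' 0%N) (Lwv 0%N); apply: eq_L2 => // t _.
  by rewrite opprB addrC subrK.
exists v => //.
have en n : energy D (fun t => w n t - v t) = energy D (fun t => w' n t - v t).
  apply: ae_eq_energy => //; first by case: (L2_sub mD (Lw n) Lv).
  exists N; split => // t /= h; apply: contrapT => tN; apply: h => _.
  by rewrite /w' memNset.
have bound n : energy D (fun t => w n t - v t) <=
    p ^+ n * (((1 - rho) ^+ 2)^-1 * \int[mu]_(t in D) g t).
  rewrite en mulrA -RintegralZl //; apply: le_Rintegral => //.
  - exact: L2_integrable.
  - exact: bnd.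
apply: (squeeze_cvgr _ (cvg_cst 0)).
  by apply: nearW => n; rewrite energy_ge0; exact: bound.
rewrite -[X in _ --> X](mul0r (((1 - rho) ^+ 2)^-1 * \int[mu]_(t in D) g t)).
by apply: cvgMl; apply: cvg_expr; rewrite gtr0_norm.
Qed.

End Completeness.

(** * Truncation, local square integrability, and almost everywhere statements *)

Section PatchTrunc.
Context {R : realType} (U : hilbertType R).
Local Notation mu := (@lebesgue_measure R).
Implicit Types (D A : set (measurableTypeR R)) (u v : R -> U) (t tau : R).

Lemma measurable_itvoo (a b : R) :
  (measurable : set (set (measurableTypeR R))) `]a, b[%classic.
Proof. exact: measurable_itv. Qed.

Lemma measurable_halfline :
  (measurable : set (set (measurableTypeR R))) halfline.
Proof. exact: measurable_itv. Qed.

Lemma L2_patch D A u : measurable D -> measurable A -> L2 (D `&` A) u ->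
  L2 D (fun t => if t \in A then u t else 0) /\
  energy D (fun t => if t \in A then u t else 0) = energy (D `&` A) u.
Proof.
move=> mD mA [su fu].
have E t : ((rnorm (if t \in A then u t else 0) ^+ 2)%:E)
    = ((fun t => (rnorm (u t) ^+ 2)%:E) \_ A) t.
  by rewrite patchE; case: ifP => // _; rewrite rnorm0 expr0n.
split; last first.
  rewrite /energy /Rintegral integral_mkcondr.
  by congr fine; apply: eq_integral => t _; rewrite E.
split.
  by apply: (@sm_patch _ _ A D u (fun=> 0)) => //; exact: sm_cst.
move: fu; rewrite integral_mkcondr.
by move=> fu; under eq_integral do rewrite E.
Qed.

Lemma L2_itvoo_cst (a b : R) (c : U) : L2 `]a, b[%classic (fun=> c).
Proof.
apply: L2_cst; first exact: measurable_itvoo.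
by rewrite lebesgue_measure_itv /=; case: ifP => _; rewrite ?ltry.
Qed.

Lemma L2loc_oo u (b : R) : L2loc u -> L2 `]0, b[ u.
Proof.
move=> Lu; have [b0|b0] := ltP 0 b; first exact: Lu.
apply: (L2_subset (measurable_itvoo 0 1) (measurable_itvoo 0 b) _ (Lu 1 ltr01)).
by move=> t /=; rewrite !in_itv /= => /andP[t0 tb]; lra.
Qed.

Lemma L2_L2loc u : L2 halfline u -> L2loc u.
Proof.
move=> Lu b _; apply: (L2_subset measurable_halfline (measurable_itvoo 0 b) _ Lu).
by move=> t /=; rewrite !in_itv /= => /andP[-> _].
Qed.

Lemma truncE tau u :
  trunc tau u = (fun t => if t \in `[0, tau]%classic then u t else 0).
Proof.
by apply/funext => t; rewrite /trunc mem_setE in_itv.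
Qed.

Lemma trunc_itvoo tau u t : `]0, tau[%classic t -> trunc tau u t = u t.
Proof.
by rewrite /trunc /= in_itv /= => /andP[t0 tt]; rewrite (ltW t0) (ltW tt).
Qed.

Lemma halfline_itvcc tau : halfline `&` `[0, tau]%classic = `]0, tau]%classic.
Proof.
apply/seteqP; split => t /=; rewrite !in_itv /=.
  by rewrite andbT => -[-> /andP[_ ->]].
by move=> /andP[t0 tt]; rewrite t0 tt (ltW t0).
Qed.

Lemma L2_trunc_energy tau u : L2loc u -> L2 halfline (trunc tau u) /\
  energy halfline (trunc tau u) = energy `]0, tau[ u.
Proof.
move=> Lu; rewrite truncE.
have Lt : L2 (halfline `&` `[0, tau]%classic) u.
  rewrite halfline_itvcc.
  have L1 := L2loc_oo (`|tau| + 1) Lu.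
  apply: (L2_subset (measurable_itvoo 0 (`|tau| + 1)) (measurable_itv _) _ L1).
  move=> t /=; rewrite !in_itv /= => /andP[-> tt] /=.
  by have := ler_norm tau; lra.
have [L ->] := L2_patch measurable_halfline (measurable_itv _) Lt; split => //.
rewrite halfline_itvcc /energy Rintegral_itv_bndo_bndc //.
exact: (L2_integrable (measurable_itvoo 0 tau) (L2loc_oo tau Lu)).
Qed.

Lemma L2_trunc tau u : L2loc u -> L2 halfline (trunc tau u).
Proof. by move=> /(L2_trunc_energy tau)[]. Qed.

Lemma energy_trunc tau u : L2loc u ->
  energy halfline (trunc tau u) = energy `]0, tau[ u.
Proof. by move=> /(L2_trunc_energy tau)[]. Qed.

Lemma L2loc_add u v : L2loc u -> L2loc v -> L2loc (fun t => u t + v t).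
Proof.
move=> Lu Lv b b0.
by apply: L2_add; [exact: measurable_itvoo|exact: Lu|exact: Lv].
Qed.

Lemma L2loc_scale (a : R) u : L2loc u -> L2loc (fun t => a%:C *: u t).
Proof. by move=> Lu b b0; apply: L2_scale; [exact: measurable_itvoo|exact: Lu]. Qed.

Lemma L2loc_sub u v : L2loc u -> L2loc v -> L2loc (fun t => u t - v t).
Proof.
move=> Lu Lv b b0.
by apply: L2_sub; [exact: measurable_itvoo|exact: Lu|exact: Lv].
Qed.

(** Write the glued function as a truncation of [u - v] plus [v]. *)
Lemma L2loc_patch A u v : measurable A ->
  L2loc u -> L2loc v -> L2loc (fun t => if t \in A then u t else v t).
Proof.
move=> mA Lu Lv b b0; have mI := measurable_itvoo 0 b.
have Ld : L2 (`]0, b[%classic `&` A) (fun t => u t - v t).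
  apply: (L2_subset mI _ _ (L2_sub mI (Lu b b0) (Lv b b0))).
    exact: measurableI.
  by move=> t [].
have [Lp _] := L2_patch mI mA Ld.
apply: eq_L2 (L2_add mI Lp (Lv b b0)) => // t _.
by case: ifP => _; rewrite ?subrK // add0r.
Qed.

(** On a bounded interval the constant [F 0] is square-integrable, and [F - F 0]
    is dominated by [k] times the argument. *)
Lemma L2loc_Lipschitz (F : U -> U) (k : R) u :
  (forall x y, rnorm (F x - F y) <= k * rnorm (x - y)) ->
  L2loc u -> L2loc (fun t => F (u t)).
Proof.
move=> hF Lu b b0; have mb := measurable_itvoo 0 b.
have sF : strongly_measurable `]0, b[ (fun t => F (u t)).
  apply: sm_comp; last by case: (Lu b b0).
  move=> a x /rnorm_cvg0P ax; apply/rnorm_cvg0P.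
  apply: (squeeze_cvgr _ (cvg_cst 0)).
    by apply: nearW => n; rewrite rnorm_ge0; exact: hF.
  by rewrite -[X in _ --> X](mulr0 k); apply: cvgMr.
have sd : strongly_measurable `]0, b[ (fun t => F (u t) - F 0).
  by apply: sm_add => //; exact: sm_cst.
have Ld : L2 `]0, b[ (fun t => F (u t) - F 0).
  apply: (L2_dominated mb sd (integrableRZ (k ^+ 2) mb (L2_integrable mb (Lu b b0)))).
  move=> t _; have h := hF (u t) 0; rewrite subr0 in h.
  by rewrite -exprMn lerXn2r ?nnegrE ?rnorm_ge0 // (le_trans _ h) ?rnorm_ge0.
apply: eq_L2 (L2_add mb Ld (L2_itvoo_cst 0 b (F 0))) => // t _.
by rewrite subrK.
Qed.

(** Monotonicity of almost everywhere statements for predicates typed on [R]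
    itself, where the filter instance of the measure is not inferred because
    the two measurable structures on [R] are only convertible. *)
Lemma ae_imply (P Q : R -> Prop) : (\forall t \ae mu, P t) ->
  (forall t, P t -> Q t) -> \forall t \ae mu, Q t.
Proof. by move=> hP PQ; exact: (@filterS _ _ (ae_filter_ringOfSetsType mu) P Q). Qed.

Lemma ae_imply2 (P P' Q : R -> Prop) : (\forall t \ae mu, P t) ->
  (\forall t \ae mu, P' t) -> (forall t, P t -> P' t -> Q t) ->
  \forall t \ae mu, Q t.
Proof.
move=> hP hP' PQ.
exact: (@filterS2 _ _ (ae_filter_ringOfSetsType mu) P P' Q).
Qed.

Lemma ae_and (P Q : R -> Prop) : (\forall t \ae mu, P t) ->
  (\forall t \ae mu, Q t) -> \forall t \ae mu, P t /\ Q t.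
Proof. by move=> hP hQ; exact: (ae_imply2 hP hQ). Qed.

(** Countably many bounded intervals exhaust the half-line. *)
Lemma ae_halfline (P : R -> Prop) :
  (forall n : nat, \forall t \ae mu, `]0, n.+1%:R[%classic t -> P t) ->
  \forall t \ae mu, halfline t -> P t.
Proof.
move=> /ae_foralln hP; apply: (ae_imply hP) => t h /=; rewrite in_itv /= andbT => t0.
have [n hn] : exists n : nat, t < n.+1%:R.
  exists (Num.bound t); rewrite -natr1; apply: ltr_wpDr => //.
  by have := archi_boundP (ltW t0).
by apply: (h n); rewrite /= in_itv /= t0.
Qed.

Lemma ae_oo_halfline (P : R -> Prop) tau :
  (\forall t \ae mu, halfline t -> P t) ->
  \forall t \ae mu, `]0, tau[%classic t -> P t.
Proof.
move=> hP; apply: (ae_imply hP) => t h; rewrite /= in_itv /= => /andP[t0 _].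
by apply: h; rewrite /= in_itv /= t0.
Qed.

End PatchTrunc.

(** * Linearity, boundedness and causality of the extended maps *)

Section ExtendedMaps.
Context {R : realType} (U X Y : hilbertType R) (S : well_posed_system U X Y).
Variables (Psioo : X -> R -> Y) (Foo : (R -> U) -> R -> Y).
Hypotheses (hPsioo : extended_output_map S Psioo) (hFoo : extended_io_map S Foo).
Local Notation mu := (@lebesgue_measure R).

Lemma Foo_eq_FF (tau : R) u : 0 <= tau -> L2loc u ->
  \forall t \ae mu, `]0, tau[%classic t -> Foo u t = FF S tau (trunc tau u) t.
Proof.
move=> t0 Lu; have [_ /(_ tau t0) h] := hFoo Lu.
apply: (ae_imply (ae_oo_halfline tau h)) => t h1 h2; rewrite -h1 //.
by rewrite trunc_itvoo.
Qed.

Lemma Psioo_eq_Psi (tau : R) x : 0 <= tau ->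
  \forall t \ae mu, `]0, tau[%classic t -> Psioo x t = Psi S tau x t.
Proof.
move=> t0; have [_ /(_ tau t0) h] := hPsioo x.
apply: (ae_imply (ae_oo_halfline tau h)) => t h1 h2; rewrite -h1 //.
by rewrite trunc_itvoo.
Qed.

Lemma Foo_sub u v : L2loc u -> L2loc v ->
  Foo (fun s => v s - u s) = (fun s => Foo v s - Foo u s) %[ae mu in halfline].
Proof.
move=> Lu Lv; apply: ae_halfline => n; set tau := n.+1%:R.
have t0 : 0 <= tau by exact: ler0n.
have Lvu : L2loc (fun s => v s - u s) by exact: L2loc_sub.
have E : trunc tau (fun s => v s - u s) =
    (fun s => (-1 : R)%:C *: trunc tau u s + trunc tau v s).
  apply/funext => s; rewrite scaleN1E /Defs.trunc; case: ifP => _.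
    by rewrite addrC.
  by rewrite oppr0 addr0.
have lin := FF_linear S (-1 : R)%:C t0 (L2_trunc tau Lu) (L2_trunc tau Lv).
apply: (ae_imply2 (ae_and (Foo_eq_FF t0 Lu) (Foo_eq_FF t0 Lv))
  (ae_and (Foo_eq_FF t0 Lvu) (ae_oo_halfline tau lin))).
move=> t [h1 h2] [h3 h4] tt; rewrite h1 // h2 // h3 // E h4 //.
by rewrite scaleN1E addrC.
Qed.

Lemma Psioo_sub x z :
  Psioo (z - x) = (fun s => Psioo z s - Psioo x s) %[ae mu in halfline].
Proof.
apply: ae_halfline => n; set tau := n.+1%:R.
have t0 : 0 <= tau by exact: ler0n.
have lin := Psi_linear S (-1 : R)%:C x z t0.
apply: (ae_imply2 (ae_and (Psioo_eq_Psi x t0) (Psioo_eq_Psi z t0))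
  (ae_and (Psioo_eq_Psi (z - x) t0) (ae_oo_halfline tau lin))).
move=> t [h1 h2] [h3 h4] tt; rewrite h1 // h2 // h3 //.
rewrite scaleN1E addrC in h4; rewrite h4 //.
by rewrite scaleN1E addrC.
Qed.

Lemma Psioo0 : Psioo 0 = (fun=> 0) %[ae mu in halfline].
Proof. by apply: (ae_imply (Psioo_sub 0 0)) => t h /h; rewrite !subrr. Qed.

Lemma Foo_bounded (tau : R) : 0 <= tau -> exists2 M : R, 0 < M &
  forall u, L2loc u -> energy `]0, tau[ (Foo u) <= M * energy `]0, tau[ u.
Proof.
move=> t0; have [M hM] := FF_bounded S t0.
exists (M ^+ 2 + 1) => [|u Lu]; first by rewrite ltr_wpDl ?sqr_ge0.
have mI := measurable_itvoo 0 tau.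
have Lt := L2_trunc tau Lu.
have LF := FF_L2 S t0 Lt.
have LF' : L2 `]0, tau[ (FF S tau (trunc tau u)).
  exact: L2loc_oo (L2_L2loc LF).
rewrite (ae_eq_energy mI _ _ (Foo_eq_FF t0 Lu)); last 2 first.
- by case: (L2loc_oo tau (hFoo Lu).1).
- by case: LF'.
apply: (@le_trans _ _ (M ^+ 2 * energy `]0, tau[ u)); last first.
  by rewrite ler_wpM2r ?energy_ge0 // lerDl.
rewrite -energy_trunc //.
apply: le_trans (energy_subset measurable_halfline mI _ LF) _.
  by move=> s /=; rewrite !in_itv /= => /andP[-> _].
rewrite -!sqr_L2norm -exprMn lerXn2r ?nnegrE ?sqrtr_ge0 ?hM //.
by apply: le_trans (hM _ Lt); exact: sqrtr_ge0.
Qed.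

(** By linearity this is the bound of [Foo_bounded] for an input of zero energy. *)
Lemma Foo_causal (tau : R) u v : 0 <= tau -> L2loc u -> L2loc v ->
  u = v %[ae mu in `]0, tau[%classic] ->
  Foo u = Foo v %[ae mu in `]0, tau[%classic].
Proof.
move=> t0 Lu Lv uv; have [M M0 hM] := Foo_bounded t0.
have Ld : L2loc (fun s => v s - u s) by exact: L2loc_sub.
have mI := measurable_itvoo 0 tau.
have e0 : energy `]0, tau[ (Foo (fun s => v s - u s)) = 0.
  apply/eqP; rewrite eq_le energy_ge0 andbT; apply: le_trans (hM _ Ld) _.
  rewrite (eq0_energy mI) ?mulr0 //; first by case: (L2loc_oo tau Ld).
  by apply: (ae_imply uv) => t h /h ->; rewrite subrr.
have := energy_eq0 mI (L2loc_oo tau (hFoo Ld).1) e0 => z.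
apply: (ae_imply2 z (ae_oo_halfline tau (Foo_sub Lu Lv))) => t h1 h2 tt.
by have := h1 tt; rewrite h2 // => /eqP; rewrite subr_eq0 => /eqP.
Qed.

Lemma Foo_ae u v : L2loc u -> L2loc v -> u = v %[ae mu in halfline] ->
  Foo u = Foo v %[ae mu in halfline].
Proof.
move=> Lu Lv uv; apply: ae_halfline => n.
exact: (Foo_causal (ler0n _ _) Lu Lv (ae_oo_halfline _ uv)).
Qed.

End ExtendedMaps.

(** * Consequences of passivity *)

Section Passive.
Context {R : realType} (U X : hilbertType R) (S : well_posed_system U X U).
Variables (Psioo : X -> R -> U) (Foo : (R -> U) -> R -> U).
Hypotheses (hPsioo : extended_output_map S Psioo) (hFoo : extended_io_map S Foo).
Hypothesis hpassive : impedance_passive S Psioo Foo.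
Local Notation mu := (@lebesgue_measure R).

(** The passivity inequality only sees the output up to null sets and the real
    part of the supply rate. *)
Lemma passive_ae x0 u y (t : R) : 0 <= t -> L2loc u -> L2 `]0, t[ y ->
  y = mild_output Psioo Foo x0 u %[ae mu in `]0, t[%classic] ->
  rnorm (mild_state S x0 u t) ^+ 2 - rnorm x0 ^+ 2
    <= 2 * \int[mu]_(s in `]0, t[) rdot (u s) (y s).
Proof.
move=> t0 Lu Ly yE; have mI := measurable_itvoo 0 t.
apply: le_trans (hpassive x0 Lu t0) _.
rewrite /Cintegral /= le_eqVlt; apply/orP; left; apply/eqP; congr (_ * _).
have su : strongly_measurable `]0, t[ u by case: (L2loc_oo t Lu).
apply: (ae_eq_Rintegral mI).
- apply: (sm_rdot mI su); apply: (sm_add _ _).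
    by case: (L2loc_oo t (hPsioo x0).1).
  by case: (L2loc_oo t (hFoo Lu).1).
- by apply: (sm_rdot mI su); case: Ly.
- by apply: (ae_imply yE) => s h /h; rewrite /mild_output => ->.
Qed.

(** The trajectory starting at 0 has nonnegative final energy. *)
Lemma Foo_monotone u (t : R) : 0 <= t -> L2loc u ->
  0 <= \int[mu]_(s in `]0, t[) rdot (u s) (Foo u s).
Proof.
move=> t0 Lu; have := @passive_ae 0 u (Foo u) t t0 Lu (L2loc_oo t (hFoo Lu).1).
rewrite rnorm0 expr0n subr0 => h.
have : 0 <= 2 * \int[mu]_(s in `]0, t[) rdot (u s) (Foo u s).
  apply: le_trans (sqr_ge0 _) (h _).
  apply: (ae_imply (ae_oo_halfline t (Psioo0 hPsioo))) => s h1 h2.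
  by rewrite /mild_output h1 // add0r.
by rewrite pmulr_rge0.
Qed.

End Passive.

(** * The feedback equation *)

Section FeedbackEquation.
Context {R : realType} (U X : hilbertType R) (S : well_posed_system U X U).
Variables (Psioo : X -> R -> U) (Foo : (R -> U) -> R -> U).
Hypotheses (hPsioo : extended_output_map S Psioo) (hFoo : extended_io_map S Foo).
Hypothesis hpassive : impedance_passive S Psioo Foo.
Variables (phi : U -> U) (gamma : R) (gamma_gt0 : 0 < gamma).
Hypothesis phi_cocoercive : forall e1 e2,
  gamma * rnorm (phi e2 - phi e1) ^+ 2 <= rdot (phi e2 - phi e1) (e2 - e1).
Local Notation mu := (@lebesgue_measure R).

Lemma L2loc_output f u : L2loc f -> L2loc u ->
  L2loc (fun t => f t - Foo u t).
Proof. by move=> Lf Lu; apply: L2loc_sub => //; exact: (hFoo Lu).1. Qed.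

Lemma L2loc_phi u : L2loc u -> L2loc (fun t => phi (u t)).
Proof.
apply: L2loc_Lipschitz => x y.
exact: (cocoercive_Lipschitz gamma_gt0 phi_cocoercive).
Qed.

(** The inputs to [phi] differ by [- (Foo w2 - Foo w1)], so cocoercivity and
    monotonicity of [Foo] force the energy of the difference to be at most 0. *)
Lemma feedback_unique (tau : R) f w1 w2 : 0 <= tau -> L2loc f ->
  L2loc w1 -> L2loc w2 ->
  w1 = (fun s => phi (f s - Foo w1 s)) %[ae mu in `]0, tau[%classic] ->
  w2 = (fun s => phi (f s - Foo w2 s)) %[ae mu in `]0, tau[%classic] ->
  w1 = w2 %[ae mu in `]0, tau[%classic].
Proof.
move=> t0 Lf L1 L2w E1 E2; have mI := measurable_itvoo 0 tau.
have Ld : L2loc (fun s => w2 s - w1 s) by exact: L2loc_sub.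
have LI := L2loc_oo tau Ld.
have LF := L2loc_oo tau (hFoo Ld).1.
have Fm := Foo_monotone hPsioo hFoo hpassive t0 Ld.
(* The representatives [p1] and [p2] satisfy the cocoercivity inequality at
   every point. *)
pose p1 s := phi (f s - Foo w1 s); pose p2 s := phi (f s - Foo w2 s).
have Lp1 : L2loc p1 by apply: L2loc_phi; exact: L2loc_output.
have Lp2 : L2loc p2 by apply: L2loc_phi; exact: L2loc_output.
have Lp := L2loc_oo tau (L2loc_sub Lp2 Lp1).
have LG := L2loc_oo tau (L2loc_sub (hFoo L2w).1 (hFoo L1).1).
suff e0 : energy `]0, tau[ (fun s => p2 s - p1 s) = 0.
  apply: (ae_imply2 (energy_eq0 mI Lp e0) (ae_and E1 E2)).
  move=> t h [h1 h2] tI; rewrite h1 // h2 //; apply/eqP; rewrite eq_sym -subr_eq0.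
  by apply/eqP; exact: h.
apply/eqP; rewrite eq_le energy_ge0 andbT -(ler_pM2l gamma_gt0) mulr0.
apply: (@le_trans _ _ (-1 * \int[mu]_(s in `]0, tau[)
    rdot (p2 s - p1 s) (Foo w2 s - Foo w1 s))); last first.
  rewrite mulN1r oppr_le0; rewrite (_ : Rintegral _ _ _ =
    \int[mu]_(s in `]0, tau[) rdot (w2 s - w1 s) (Foo (fun s => w2 s - w1 s) s)) //.
  apply: (ae_eq_Rintegral mI).
  - by apply: (sm_rdot mI); [case: Lp|case: LG].
  - by apply: (sm_rdot mI); [case: LI|case: LF].
  - apply: (ae_imply2 (ae_oo_halfline tau (Foo_sub hFoo L1 L2w))
      (ae_and E1 E2)) => t h [h1 h2] tI.
    by rewrite h1 // h2 // h.
have ir := rdot_integrable mI Lp LG.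
have ie := L2_integrable mI Lp.
rewrite -!RintegralZl //; apply: le_Rintegral => //.
- exact: (integrableRZ _ mI ie).
- exact: (integrableRZ _ mI ir).
- move=> t _; apply: le_trans (phi_cocoercive _ _) _.
  by rewrite opprD addrACA subrr add0r -opprD rdotNr mulN1r.
Qed.

(** A fixed point of [K w = J (w - r Foo w + r f)], where [J] is the resolvent of
    [cocoercive_resolvent]; the choice [r = gamma / M] makes [r ^ 2 M = r gamma]. *)
Lemma feedback_local (tau : R) f : 0 < tau -> L2loc f ->
  exists2 w, L2loc w &
    w = (fun s => phi (f s - Foo w s)) %[ae mu in `]0, tau[%classic].
Proof.
move=> tau0 Lf; have t0 := ltW tau0; have mI := measurable_itvoo 0 tau.
have [M M0 hM] := Foo_bounded hFoo t0.
pose r := gamma / M; have r0 : 0 < r by rewrite divr_gt0.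
pose q := 1 + r * gamma.
have q1 : 1 < q by rewrite ltrDl mulr_gt0.
have q0 : 0 < q by exact: lt_trans q1.
have [J hJ Jlip] := cocoercive_resolvent gamma_gt0 phi_cocoercive r0.
pose K w s := J (w s - r%:C *: Foo w s + r%:C *: f s).
have Jlip' x y : rnorm (J x - J y) <= q^-1 * rnorm (x - y).
  by rewrite ler_pdivlMl //; exact: Jlip.
have LK w : L2loc w -> L2loc (K w).
  move=> Lw; apply: (L2loc_Lipschitz Jlip'); apply: L2loc_add.
    by apply: L2loc_sub => //; apply: L2loc_scale; exact: (hFoo Lw).1.
  exact: L2loc_scale.
have contr u v : L2loc u -> L2loc v ->
    energy `]0, tau[ (fun s => K v s - K u s) <=
    q^-1 * energy `]0, tau[ (fun s => v s - u s).
  move=> Lu Lv; have Ld := L2loc_sub Lv Lu.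
  have Ldd := L2loc_sub (hFoo Lv).1 (hFoo Lu).1.
  have LdI := L2loc_oo tau Ld; have LdF := L2loc_oo tau Ldd.
  have LFd := L2loc_oo tau (hFoo Ld).1.
  have Fsub := ae_oo_halfline tau (Foo_sub hFoo Lu Lv).
  have LKI := L2loc_oo tau (L2loc_sub (LK _ Lv) (LK _ Lu)).
  have h1 : energy `]0, tau[ (fun s => q%:C *: (K v s - K u s)) <=
      energy `]0, tau[ (fun s => (v s - u s) - r%:C *: (Foo v s - Foo u s)).
    apply: (le_energy mI); first exact: L2_scale.
      by apply: (L2_sub mI) => //; exact: L2_scale.
    move=> s _; rewrite rnormZ gtr0_norm //; apply: le_trans (Jlip _ _) _.
    rewrite le_eqVlt; apply/orP; left; apply/eqP; congr (rnorm _).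
    rewrite scalerBr opprD addrACA subrr addr0 !opprD !opprK.
    by rewrite addrACA.
  rewrite energyZ // energyBZ // in h1.
  have -> : energy `]0, tau[ (fun s => K v s - K u s) =
      q^-1 * (q^-1 * (q ^+ 2 * energy `]0, tau[ (fun s => K v s - K u s))).
    by field; rewrite gt_eqF.
  rewrite ler_pM2l ?invr_gt0 // ler_pdivrMl //.
  apply: le_trans h1 _.
  have eF : energy `]0, tau[ (fun s => Foo v s - Foo u s) =
      energy `]0, tau[ (Foo (fun s => v s - u s)).
    apply: (ae_eq_energy mI); [by case: LdF|by case: LFd|].
    by apply: (ae_imply Fsub) => s h /h ->.
  have iF : \int[mu]_(s in `]0, tau[) rdot (v s - u s) (Foo v s - Foo u s) =
      \int[mu]_(s in `]0, tau[) rdot (v s - u s) (Foo (fun s => v s - u s) s).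
    apply: (ae_eq_Rintegral mI).
    - by apply: (sm_rdot mI); [case: LdI|case: LdF].
    - by apply: (sm_rdot mI); [case: LdI|case: LFd].
    - by apply: (ae_imply Fsub) => s h /h ->.
  rewrite eF iF.
  have /(mulr_ge0 (ltW r0)) := Foo_monotone hPsioo hFoo hpassive t0 Ld.
  have := hM _ Ld; rewrite -(@ler_pM2l _ (r ^+ 2)) ?exprn_gt0 //.
  rewrite mulrA (_ : r ^+ 2 * M = r * gamma); last by rewrite /r; field; rewrite gt_eqF.
  by rewrite /q mulrDl mul1r; lra.
pose w n := iter n K (fun=> 0).
have Lw n : L2loc (w n).
  elim: n => [|n IH]; last exact: LK.
  by apply: L2_L2loc; apply: L2_0; exact: measurable_halfline.
have [|||v Lv cv] := @L2_geometric_limit _ U _ w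
    (energy `]0, tau[ (fun s => w 1%N s - w 0%N s)) q^-1 mI.
- by rewrite invr_ge0 (ltW q0) invf_lt1.
- by move=> n; exact: L2loc_oo.
- elim=> [|n IH]; first by rewrite expr0 mulr1.
  rewrite exprS mulrCA; apply: le_trans (contr _ _ (Lw n) (Lw n.+1)) _.
  by rewrite ler_wpM2l // invr_ge0 ltW.
have sI : halfline `&` `]0, tau[%classic = `]0, tau[%classic :> set R.
  by apply/setIidPr => s /=; rewrite !in_itv /= => /andP[-> _].
pose vI s : U := if s \in `]0, tau[%classic then v s else 0.
have LvI : L2loc vI.
  apply: L2_L2loc.
  have [] // := @L2_patch _ U halfline `]0, tau[%classic v measurable_halfline mI.
  by rewrite sI.
have vIE s : `]0, tau[%classic s -> vI s = v s by move=> h; rewrite /vI mem_set.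
have en n : energy `]0, tau[ (fun s => w n s - v s) =
    energy `]0, tau[ (fun s => vI s - w n s).
  apply: eq_Rintegral => s; rewrite inE => sIn.
  by rewrite rnorm_distC vIE.
have fixed : energy `]0, tau[ (fun s => vI s - K vI s) = 0.
  apply/eqP; rewrite eq_le energy_ge0 andbT.
  have b n : energy `]0, tau[ (fun s => vI s - K vI s) <=
     2 * energy `]0, tau[ (fun s => w n.+1 s - v s) +
     2 * (q^-1 * energy `]0, tau[ (fun s => w n s - v s)).
    apply: (@le_trans _ _ (2 * energy `]0, tau[ (fun s => vI s - w n.+1 s) +
      2 * energy `]0, tau[ (fun s => w n.+1 s - K vI s))).
      apply: le_trans (energyD_le mI (L2loc_oo tau (L2loc_sub LvI (Lw n.+1)))
        (L2loc_oo tau (L2loc_sub (Lw n.+1) (LK _ LvI)))).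
      rewrite le_eqVlt; apply/orP; left; apply/eqP; apply: eq_Rintegral => s _.
      by rewrite subrKA.
    rewrite en lerD2l ler_pM2l //.
    by rewrite en -(energy_distC _ (w n)); exact: contr.
  have cl : (fun n => 2 * energy `]0, tau[ (fun s => w n.+1 s - v s) +
     2 * (q^-1 * energy `]0, tau[ (fun s => w n s - v s))) @ \oo --> (0 : R).
    rewrite [X in _ --> X](_ : _ = 2 * 0 + 2 * (q^-1 * 0)); last first.
      by rewrite !mulr0 addr0.
    apply: cvgD; apply: cvgMr; last by apply: cvgMr; exact: cv.
    by move: cv; rewrite -cvg_shiftS.
  rewrite -[leRHS](cvg_lim _ cl) //; apply: limr_ge; first exact: cvgP cl.
  by apply: nearW => n; exact: b.
have := energy_eq0 mI (L2loc_oo tau (L2loc_sub LvI (LK _ LvI))) fixed => z.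
exists vI => //; apply: (ae_imply z) => s h sIn.
have /eqP := h sIn; rewrite subr_eq0 => /eqP vK.
have [e Je re] := hJ (vI s - r%:C *: Foo vI s + r%:C *: f s).
have vp : vI s = phi e by rewrite {1}vK.
suff -> : f s - Foo vI s = e by [].
have rn0 : r%:C != 0 :> R[i] by rewrite (inj_eq (@complexI _)) gt_eqF.
apply: (scalerI rn0); move: re; rewrite -/(K vI s) -vK -addrA => /addrI ->.
by rewrite scalerBr addrC.
Qed.
End FeedbackEquation.

Section GlobalFeedback.
Context {R : realType} (U X : hilbertType R) (S : well_posed_system U X U).
Variables (Psioo : X -> R -> U) (Foo : (R -> U) -> R -> U).
Hypotheses (hPsioo : extended_output_map S Psioo) (hFoo : extended_io_map S Foo).
Hypothesis hpassive : impedance_passive S Psioo Foo.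
Variables (phi : U -> U) (gamma : R) (gamma_gt0 : 0 < gamma).
Hypothesis phi_cocoercive : forall e1 e2,
  gamma * rnorm (phi e2 - phi e1) ^+ 2 <= rdot (phi e2 - phi e1) (e2 - e1).
Local Notation mu := (@lebesgue_measure R).

(** The solutions [W n] on ]0, n+1[ agree where they overlap only almost
    everywhere, so evaluating them at an index depending on the time would not
    preserve measurability.  The functions [G n] freeze the earlier values and
    agree everywhere on overlaps. *)
Lemma feedback_global f : L2loc f -> exists2 w, L2loc w &
  w = (fun s => phi (f s - Foo w s)) %[ae mu in halfline].
Proof.
move=> Lf.
have /choice [W hW] n : exists w, L2loc w /\
    w = (fun s => phi (f s - Foo w s)) %[ae mu in `]0, n.+1%:R[%classic].
  have [w Lw Ew] := @feedback_local _ _ _ S _ _ hPsioo hFoo hpassive phi gamma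
    gamma_gt0 phi_cocoercive n.+1%:R f (ltr0Sn _ _) Lf.
  by exists w.
pose fix G n (t : R) {struct n} : U := if n is k.+1 then
  (if t \in `]0, k.+1%:R[%classic then G k t else W k.+1 t) else W 0%N t.
have GS n t : G n.+1 t = if t \in `]0, n.+1%:R[%classic then G n t else W n.+1 t by [].
have LG n : L2loc (G n).
  elim: n => [|n IH]; first exact: (hW 0%N).1.
  by apply: L2loc_patch => //; exact: (hW n.+1).1.
have mono m n t : (m <= n)%N -> `]0, m.+1%:R[%classic t -> `]0, n.+1%:R[%classic t.
  rewrite /= !in_itv /= => mn /andP[-> tm] /=.
  by apply: lt_le_trans tm _; rewrite ler_nat ltnS.
have GW n : G n = W n %[ae mu in `]0, n.+1%:R[%classic].
  elim: n => [|n IH]; first by apply: aeW.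
  have u := feedback_unique hPsioo hFoo hpassive gamma_gt0 phi_cocoercive
    (ler0n R n.+1) Lf (hW n).1 (hW n.+1).1 (hW n).2.
  have hn : W n.+1 = (fun s => phi (f s - Foo (W n.+1) s))
      %[ae mu in `]0, n.+1%:R[%classic].
    by apply: (ae_imply (hW n.+1).2) => t h tn; apply: h; apply: mono tn.
  apply: (ae_imply2 IH (u hn)) => t h1 h2 _; rewrite GS.
  by case: ifPn => //; rewrite inE => tn; rewrite h1 // h2.
have Gst n m t : (n <= m)%N -> `]0, n.+1%:R[%classic t -> G m t = G n t.
  move=> + tn; elim: m => [|m IH]; first by rewrite leqn0 => /eqP ->.
  rewrite leq_eqVlt => /orP[/eqP -> //|]; rewrite ltnS => nm.
  by rewrite GS mem_set ?IH //; apply: mono tn.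
(* For [t > 0], [Num.bound t] is an integer above [t], so that [t] lies in the
   interval where [G] is already frozen. *)
pose w t := G (Num.bound t) t.
have wG n t : `]0, n.+1%:R[%classic t -> w t = G n t.
  move=> tn; have tb : `]0, (Num.bound t).+1%:R[%classic t.
    move: tn; rewrite /= !in_itv /= => /andP[t0 _]; rewrite t0 /= -natr1.
    by apply: ltr_wpDr => //; have := archi_boundP (ltW t0).
  rewrite /w; have [le|/ltnW le] := leqP (Num.bound t) n.
    by rewrite (Gst _ _ _ le tb).
  by rewrite (Gst _ _ _ le tn).
have Lw : L2loc w.
  move=> b b0; have mI := measurable_itvoo 0 b.
  apply: (eq_L2 mI _ (LG (Num.bound b) b b0)) => t tb; rewrite (wG (Num.bound b)) //.
  move: tb; rewrite /= !in_itv /= => /andP[-> tb] /=; apply: lt_trans tb _.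
  by rewrite -natr1; apply: ltr_wpDr => //; have := archi_boundP (ltW b0).
exists w => //; apply: ae_halfline => n.
have F1 := Foo_causal hFoo (ler0n R n.+1) (LG n) (hW n).1 (GW n).
have wGn : w = G n %[ae mu in `]0, n.+1%:R[%classic] by apply: aeW => t; exact: wG.
have F2 := Foo_causal hFoo (ler0n R n.+1) Lw (LG n) wGn.
apply: (ae_imply2 (ae_and F1 F2)
  (ae_and (GW n) (hW n).2)) => t [h1 h2] [h3 h4] tn.
by rewrite (wG n) // h3 // h4 // h2 // h1.
Qed.

End GlobalFeedback.

(** * Continuity of trajectories *)

Section Trajectories.
Context {R : realType} (U X : hilbertType R) (S : well_posed_system U X U).
Variables (Psioo : X -> R -> U) (Foo : (R -> U) -> R -> U).
Hypotheses (hPsioo : extended_output_map S Psioo) (hFoo : extended_io_map S Foo).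
Hypothesis hpassive : impedance_passive S Psioo Foo.
Local Notation mu := (@lebesgue_measure R).

Lemma Phi_sub (t : R) u v : 0 <= t -> L2 halfline u -> L2 halfline v ->
  Phi S t (fun s => v s - u s) = Phi S t v - Phi S t u.
Proof.
move=> t0 Lu Lv; have := Phi_linear S (-1 : R)%:C t0 Lu Lv.
rewrite scaleN1E addrC => <-; congr (Phi S t _).
by apply/funext => s; rewrite scaleN1E addrC.
Qed.

Lemma Phi_0 (t : R) : 0 <= t -> Phi S t (fun=> 0) = 0.
Proof.
move=> t0; have L0 : L2 halfline (fun=> 0 : U).
  by apply: L2_0; exact: measurable_halfline.
by have := Phi_sub t0 L0 L0; rewrite !subrr.
Qed.

Lemma sgT_sub (t : R) x z : 0 <= t -> sgT S t (z - x) = sgT S t z - sgT S t x.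
Proof.
move=> t0; have [lT _] := sgT_bounded S t0.
by have := lT (-1 : R)%:C x z; rewrite !scaleN1E [- x + z]addrC => ->; rewrite addrC.
Qed.

Lemma sgT_0 (t : R) : 0 <= t -> sgT S t 0 = 0.
Proof. by move=> t0; have := sgT_sub 0 0 t0; rewrite !subrr. Qed.

Lemma mild_state_sub x1 x2 u1 u2 (t : R) : 0 <= t -> L2loc u1 -> L2loc u2 ->
  mild_state S (x2 - x1) (fun s => u2 s - u1 s) t =
  mild_state S x2 u2 t - mild_state S x1 u1 t.
Proof.
move=> t0 L1 L2'; rewrite /mild_state sgT_sub // opprD addrACA; congr (_ + _).
rewrite -Phi_sub //; try exact: L2_trunc; congr (Phi S t _).
apply/funext => s; rewrite /Defs.trunc; case: ifP => _ //.
by rewrite subrr.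
Qed.

(** Passivity with zero input. *)
Lemma sgT_contraction (t : R) x : 0 <= t -> rnorm (sgT S t x) <= rnorm x.
Proof.
move=> t0; have L0 : L2loc (fun=> 0 : U).
  by apply: L2_L2loc; apply: L2_0; exact: measurable_halfline.
have Ly : L2 `]0, t[ (mild_output Psioo Foo x (fun=> 0)).
  apply: (L2_add (measurable_itvoo 0 t)); apply: L2loc_oo.
    exact: (hPsioo x).1.
  exact: (hFoo L0).1.
have := passive_ae hPsioo hFoo hpassive t0 L0 Ly (aeW _ (fun s _ => erefl)).
rewrite (_ : Rintegral _ _ _ = 0); last first.
  by rewrite /Rintegral integral0_eq // => s _; rewrite rdot0l.
rewrite mulr0 subr_le0 /mild_state (_ : trunc t (fun=> 0) = (fun=> 0)); last first.
  by apply/funext => s; rewrite /Defs.trunc if_same.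
by rewrite Phi_0 // addr0 ler_pXn2r ?nnegrE ?rnorm_ge0.
Qed.

(** Passivity from the initial state 0 bounds the state by the supplied energy,
    which is at most a multiple of the input energy.  By causality the
    constant of [Foo] on the largest interval serves for all shorter ones. *)
Lemma Phi_energy (T0 : R) : 0 <= T0 -> exists2 C : R, 0 < C & forall t u,
  0 <= t <= T0 -> L2loc u ->
  rnorm (Phi S t (trunc t u)) ^+ 2 <= C * energy `]0, t[ u.
Proof.
move=> T00; have [M M0 hM] := Foo_bounded hFoo T00.
exists (1 + M) => [|t u /andP[t0 tT] Lu]; first by rewrite addr_gt0.
have mI := measurable_itvoo 0 t; have mT := measurable_itvoo 0 T0.
have LF := (hFoo Lu).1.
have LuI := L2loc_oo t Lu; have LFI := L2loc_oo t LF.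
have Psi0ae : Foo u = mild_output Psioo Foo 0 u %[ae mu in `]0, t[%classic].
  apply: (ae_imply (ae_oo_halfline t (Psioo0 hPsioo))) => s h sI.
  by rewrite /mild_output h // add0r.
have := passive_ae hPsioo hFoo hpassive t0 Lu LFI Psi0ae.
rewrite /mild_state sgT_0 // add0r rnorm0 expr0n subr0 => h.
apply: le_trans h _.
have Lt := L2_L2loc (L2_trunc t Lu).
have cau : Foo u = Foo (trunc t u) %[ae mu in `]0, t[%classic].
  apply: (Foo_causal hFoo t0 Lu Lt); apply: aeW => s sI.
  by rewrite trunc_itvoo.
have eF : energy `]0, t[ (Foo u) <= M * energy `]0, t[ u.
  rewrite (ae_eq_energy mI _ _ cau); [|by case: LFI|by case: (L2loc_oo t (hFoo Lt).1)].
  apply: le_trans (energy_subset mT mI _ (L2loc_oo T0 (hFoo Lt).1)) _.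
    by move=> s /=; rewrite !in_itv /= => /andP[-> /lt_le_trans]; apply.
  apply: le_trans (hM _ Lt) _; rewrite ler_pM2l // -(energy_trunc t) //.
  apply: (energy_subset measurable_halfline mT _ (L2_trunc t Lu)).
  by move=> s /=; rewrite !in_itv /= => /andP[->].
rewrite [(1 + M) * _]mulrDl mul1r; apply: le_trans _ (lerD (lexx _) eF).
have iu := L2_integrable mI LuI; have iF := L2_integrable mI LFI.
have ir := rdot_integrable mI LuI LFI.
rewrite -RintegralZl // -RintegralD //; apply: le_Rintegral => //.
- exact: (integrableRZ _ mI ir).
- exact: (integrableRD mI iu iF).
- move=> s _; have := @rdot_Young _ _ 1 (u s) (Foo u s) ltr01.
  by rewrite invr1 !mul1r.
Qed.

(** Absolute continuity of the integral. *)
Lemma L2loc_tail_energy (T0 : R) (w : R -> U) : L2loc w -> forall e : R, 0 < e ->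
  exists2 d : R, 0 < d & forall s t, 0 <= s <= t -> t <= T0 -> t - s < d ->
    energy (`]0, t[ `&` `[s, +oo[%classic) w < e.
Proof.
move=> Lw e e0; have mT := measurable_itvoo 0 T0.
have LT : L2 (setT `&` `]0, T0[%classic) w by rewrite setTI; exact: L2loc_oo.
have [Lp _] := L2_patch measurableT mT LT.
have := L2_integrable (measurableT : measurable (setT : set (measurableTypeR R))) Lp.
move=> /integral_normr_continuous /(_ _ e0) [d [d0 hd]].
exists d => // s t /andP[s0 st] tT tsd.
set A : set (measurableTypeR R) := `]0, t[ `&` `[s, +oo[%classic.
have mA : measurable A by apply: measurableI; exact: measurable_itv.
have := hd A mA; rewrite (_ : Rintegral _ _ _ = energy A w); last first.
  apply: eq_Rintegral => r; rewrite inE => -[/= rt _].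
  rewrite ger0_norm ?sqr_ge0 // mem_set //.
  by move: rt; rewrite /= !in_itv /= => /andP[-> /lt_le_trans]; apply.
apply; apply: (@le_lt_trans _ _ (mu `[s, t[%classic)).
  apply: le_measure; [exact: mem_set|by apply: mem_set; exact: measurable_itv|].
  by move=> r [/=]; rewrite !in_itv /= andbT => /andP[_ ->] ->.
rewrite lebesgue_measure_itv /= lte_fin.
by case: ifP => _; rewrite ?lte_fin // -EFinD lte_fin.
Qed.

(** Letting the system run with zero input after time [s] is the composition
    law with [v = 0]; the difference with the actual trajectory is the state
    reached from 0 by the part of the input after time [s]. *)
Lemma Phi_increment (T0 : R) : 0 <= T0 -> exists2 C : R, 0 < C &
  forall x0 w s t, L2loc w -> 0 <= s <= t -> t <= T0 ->
  rnorm (mild_state S x0 w t - sgT S (t - s) (mild_state S x0 w s)) ^+ 2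
    <= C * energy (`]0, t[ `&` `[s, +oo[%classic) w.
Proof.
move=> T00; have [C C0 hC] := Phi_energy T00; exists C => //.
move=> x0 w s t Lw /andP[s0 st] tT.
have t0 := le_trans s0 st; have ts0 : 0 <= t - s by rewrite subr_ge0.
have L0 : L2 halfline (fun=> 0 : U) by apply: L2_0; exact: measurable_halfline.
have mA : measurable (`[s, +oo[%classic : set (measurableTypeR R)).
  exact: measurable_itv.
pose w' r := if r \in `[s, +oo[%classic then w r else 0.
have Lw' : L2loc w' by apply: L2loc_patch => //; exact: L2_L2loc.
have Lts := L2_trunc s Lw; have Ltt := L2_trunc t Lw.
(* The input stopped at time [s] is the input on [0, t] minus its part after
   time [s]; the equality holds at every point because the concatenation takes
   its second branch at time [s] itself. *)
have dE : diamond s (trunc s w) (fun=> 0) = (fun r => trunc t w r - trunc t w' r).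
  apply/funext => r; rewrite /diamond /Defs.trunc /w' mem_setE in_itv /= andbT.
  have [rs|sr] := ltP r s.
    rewrite (le_trans (ltW rs) st) (ltW rs); case: ifP => _; rewrite ?subr0 //.
  by case: ifP => _; rewrite subrr.
have := PhiD S s0 ts0 Lts L0; rewrite subrKC Phi_0 // addr0 dE.
rewrite Phi_sub //; last exact: L2_trunc.
move=> hPhi.
have -> : mild_state S x0 w t - sgT S (t - s) (mild_state S x0 w s) =
   Phi S t (trunc t w').
  have sgTadd a b : sgT S (t - s) (a + b) = sgT S (t - s) a + sgT S (t - s) b.
    by rewrite -{1}[b]opprK sgT_sub // -sub0r sgT_sub // sgT_0 // sub0r opprK.
  rewrite /mild_state sgTadd -hPhi -sgTD // subrKC.
  by rewrite opprD addrACA subrr add0r opprB subrKC.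
apply: le_trans (hC t w' _ Lw') _; first by rewrite t0.
rewrite ler_pM2l // /w'.
have mI := measurable_itvoo 0 t.
have LA : L2 (`]0, t[%classic `&` `[s, +oo[%classic) w.
  apply: (L2_subset mI _ _ (L2loc_oo t Lw)); first exact: measurableI.
  by move=> r [].
by have [_ ->] := L2_patch mI mA LA.
Qed.

End Trajectories.

Section Continuity.
Context {R : realType} (U X : hilbertType R) (S : well_posed_system U X U).
Variables (Psioo : X -> R -> U) (Foo : (R -> U) -> R -> U).
Hypotheses (hPsioo : extended_output_map S Psioo) (hFoo : extended_io_map S Foo).
Hypothesis hpassive : impedance_passive S Psioo Foo.
Local Notation mu := (@lebesgue_measure R).

Lemma sgT_cvg0 x (e : R) : 0 < e -> exists2 d : R, 0 < d &
  forall h, 0 <= h < d -> rnorm (sgT S h x - x) < e.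
Proof.
move=> e0; have /rnorm_cvgP/(_ e e0) [d /= d0 hd] := @sgT_continuous _ _ _ _ S x.
exists d => // h /andP[]; rewrite le_eqVlt => /orP[/eqP <- _|h0 hd'].
  by rewrite sgT0 subrr rnorm0.
by apply: hd => //=; rewrite sub0r normrN gtr0_norm.
Qed.

(** On the right of [t] the trajectory is the free evolution of [x t] up to a
    small input contribution.  On the left, [x s] and [x t] are both compared
    with free evolutions from a fixed earlier time [a], close enough that the
    input between [a] and [t] is negligible; by contractivity these two free
    evolutions differ by at most [|sgT (t - s) (x a) - x a|]. *)
Lemma mild_state_continuous x0 w : L2loc w ->
  {within `[0, +oo[, continuous (mild_state S x0 w)}.
Proof.
move=> Lw; apply/subspace_continuousP => t; rewrite /= in_itv /= andbT => t0.
set x := mild_state S x0 w.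
apply/rnorm_cvgP => e e0.
have e40 : 0 < e / 4 by rewrite divr_gt0.
have T00 : 0 <= t + 1 by rewrite addr_ge0.
have [C C0 hC] := Phi_increment hPsioo hFoo hpassive T00.
have ee0 : 0 < (e / 4) ^+ 2 / C by rewrite divr_gt0 ?exprn_gt0.
have [eta eta0 heta] := L2loc_tail_energy (t + 1) Lw ee0.
have incr a b : 0 <= a <= b -> b <= t + 1 -> b - a < eta ->
    rnorm (x b - sgT S (b - a) (x a)) < e / 4.
  move=> ab bt ba; rewrite -(@ltr_pXn2r _ 2) ?nnegrE ?rnorm_ge0 ?(ltW e40) //.
  apply: le_lt_trans (hC x0 w a b Lw ab bt) _.
  by rewrite -ltr_pdivlMl // mulrC; exact: heta.
(* The earlier time of comparison; for [t = 0] only the right side matters. *)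
pose a := Num.max 0 (t - eta / 2).
have a0 : 0 <= a by rewrite le_max lexx.
have at_ : a <= t by rewrite ge_max t0 /= gerBl divr_ge0 // ltW.
have ta : t - a < eta.
  have : t - eta / 2 <= a by rewrite le_max lexx orbT.
  by lra.
have [d1 d10 hd1] := sgT_cvg0 (x a) e40.
have [d2 d20 hd2] := sgT_cvg0 (x t) e40.
pose d := Num.min (Num.min (eta / 2) 1) (Num.min d1 d2).
have d0 : 0 < d by rewrite !lt_min d10 d20 ltr01 divr_gt0.
exists d => //= s; rewrite /ball_ /= => ts; rewrite in_itv /= andbT => s0.
have [[de d1'] [dd1 dd2]] : (d <= eta / 2 /\ d <= 1) /\ (d <= d1 /\ d <= d2).
  by rewrite /d !ge_min !lexx ?orbT.
have [ts'|st] := leP t s.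
  rewrite ler0_norm ?subr_le0 // opprB in ts.
  have h1 : rnorm (x s - sgT S (s - t) (x t)) < e / 4.
    by apply: incr; [rewrite t0|lra|lra].
  have h2 : rnorm (sgT S (s - t) (x t) - x t) < e / 4.
    by apply: hd2; apply/andP; split; lra.
  have := rnormD (x s - sgT S (s - t) (x t)) (sgT S (s - t) (x t) - x t).
  by rewrite subrKA; lra.
rewrite gtr0_norm ?subr_gt0 // in ts.
have as_ : a <= s.
  by rewrite ge_max s0 /=; lra.
have h1 : rnorm (x t - sgT S (t - a) (x a)) < e / 4.
  by apply: incr; [rewrite a0|lra|].
have h2 : rnorm (x s - sgT S (s - a) (x a)) < e / 4.
  by apply: incr; [rewrite a0|lra|lra].
have sa0 : 0 <= s - a by rewrite subr_ge0.
have ts0 : 0 <= t - s by rewrite subr_ge0 ltW.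
have h3 : rnorm (sgT S (t - a) (x a) - sgT S (s - a) (x a)) < e / 4.
  rewrite (_ : t - a = (t - s) + (s - a)); last by ring.
  rewrite sgTD // -sgT_sub //.
  apply: le_lt_trans (sgT_contraction hPsioo hFoo hpassive _ sa0) _.
  by apply: hd1; rewrite ts0; lra.
have := rnormD (x t - sgT S (t - a) (x a)) (sgT S (t - a) (x a) - x s).
have := rnormD (sgT S (t - a) (x a) - sgT S (s - a) (x a)) (sgT S (s - a) (x a) - x s).
rewrite !subrKA (rnorm_distC _ (x s)) (rnorm_distC (x t) (x s)) (rnorm_distC _ (x s)).
lra.
Qed.

End Continuity.

(** * The incremental estimate *)

Section Estimate.
Context {R : realType} (U X : hilbertType R) (S : well_posed_system U X U).
Variables (Psioo : X -> R -> U) (Foo : (R -> U) -> R -> U).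
Hypotheses (hPsioo : extended_output_map S Psioo) (hFoo : extended_io_map S Foo).
Hypothesis hpassive : impedance_passive S Psioo Foo.
Variables (phi : U -> U) (gamma : R) (gamma_gt0 : 0 < gamma).
Hypothesis phi_cocoercive : forall e1 e2,
  gamma * rnorm (phi e2 - phi e1) ^+ 2 <= rdot (phi e2 - phi e1) (e2 - e1).
Local Notation mu := (@lebesgue_measure R).

Lemma is_solution_mild_state x0 v x y t :
  is_solution S Psioo Foo phi x0 v x y -> 0 <= t ->
  x t = mild_state S x0 (fun s => phi (v s - y s)) t.
Proof. by move=> [_ _ hx _] t0; rewrite hx. Qed.

(** [Phi 0] vanishes by the bound of [Phi_energy] on the empty interval. *)
Lemma is_solution_at0 x0 v x y : L2loc v -> is_solution S Psioo Foo phi x0 v x y ->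
  x 0 = x0.
Proof.
move=> Lv sol; have [_ Ly _ _] := sol.
have Lw : L2loc (fun s => phi (v s - y s)).
  by apply: (L2loc_phi gamma_gt0 phi_cocoercive); exact: L2loc_sub.
rewrite (is_solution_mild_state sol) // /mild_state sgT0.
have [C C0 /(_ 0 _ _ Lw)] := Phi_energy hPsioo hFoo hpassive (lexx 0).
rewrite lexx => /(_ isT); rewrite /energy set_itvoo0 Rintegral_set0 mulr0.
rewrite le_eqVlt ltNge sqr_ge0 orbF sqrf_eq0 => /eqP/rnorm0_eq0 ->.
by rewrite addr0.
Qed.

(** Passivity of the difference trajectory, with the supply rate bounded
    pointwise by Young's inequality and cocoercivity. *)
Lemma is_solution_estimate x01 x02 v1 v2 x1 x2 y1 y2 t :
  L2loc v1 -> L2loc v2 ->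
  is_solution S Psioo Foo phi x01 v1 x1 y1 ->
  is_solution S Psioo Foo phi x02 v2 x2 y2 -> 0 <= t ->
  rnorm (x2 t - x1 t) ^+ 2 + gamma *
    energy `]0, t[ (fun s => phi (v2 s - y2 s) - phi (v1 s - y1 s))
  <= rnorm (x02 - x01) ^+ 2 + gamma^-1 * energy `]0, t[ (fun s => v2 s - v1 s).
Proof.
move=> Lv1 Lv2 sol1 sol2 t0.
have [_ Ly1 _ Ey1] := sol1; have [_ Ly2 _ Ey2] := sol2.
set w1 := fun s => phi (v1 s - y1 s); set w2 := fun s => phi (v2 s - y2 s).
have mI := measurable_itvoo 0 t.
have L1 : L2loc w1 by apply: (L2loc_phi gamma_gt0 phi_cocoercive); exact: L2loc_sub.
have L2' : L2loc w2 by apply: (L2loc_phi gamma_gt0 phi_cocoercive); exact: L2loc_sub.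
have Lw := L2loc_sub L2' L1.
have LwI := L2loc_oo t Lw.
have LyI := L2loc_oo t (L2loc_sub Ly2 Ly1).
have LvI := L2loc_oo t (L2loc_sub Lv2 Lv1).
have Ey : (fun s => y2 s - y1 s) =
    mild_output Psioo Foo (x02 - x01) (fun s => w2 s - w1 s)
    %[ae mu in `]0, t[%classic].
  have F := ae_oo_halfline t (Foo_sub hFoo L1 L2').
  have P := ae_oo_halfline t (Psioo_sub hPsioo x01 x02).
  apply: (ae_imply2 (ae_and F P)
    (ae_and (ae_oo_halfline t Ey1) (ae_oo_halfline t Ey2))).
  move=> s [h1 h2] [h3 h4] sI; rewrite /mild_output h1 // h2 // h3 // h4 //.
  by rewrite opprD addrACA.
have := passive_ae hPsioo hFoo hpassive t0 Lw LyI Ey.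
rewrite mild_state_sub //.
rewrite -(is_solution_mild_state sol1) // -(is_solution_mild_state sol2) // => h.
have iw := L2_integrable mI LwI; have iv := L2_integrable mI LvI.
have iy := rdot_integrable mI LwI LyI.
suff : 2 * \int[mu]_(s in `]0, t[) rdot (w2 s - w1 s) (y2 s - y1 s) <=
   gamma^-1 * energy `]0, t[ (fun s => v2 s - v1 s) +
   - gamma * energy `]0, t[ (fun s => w2 s - w1 s) by lra.
have ivZ := integrableRZ gamma^-1 mI iv; have iwZ := integrableRZ (- gamma) mI iw.
rewrite -!RintegralZl // -RintegralD //; apply: le_Rintegral => //.
- exact: (integrableRZ _ mI iy).
- exact: (integrableRD mI ivZ iwZ).
- move=> s _.
  have := phi_cocoercive (v1 s - y1 s) (v2 s - y2 s); rewrite -/(w1 s) -/(w2 s).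
  have -> : v2 s - y2 s - (v1 s - y1 s) = (v2 s - v1 s) - (y2 s - y1 s).
    by rewrite !opprD !opprK addrACA.
  rewrite rdotDr rdotNr.
  have := rdot_Young (w2 s - w1 s) (v2 s - v1 s) gamma_gt0.
  by lra.
Qed.

End Estimate.

(** * The feedback theorem *)

Theorem theorem1p1 (R : realType) (U X : hilbertType R)
  (S : well_posed_system U X U)
  (Psioo : X -> R -> U) (Foo : (R -> U) -> R -> U)
  (hPsioo : extended_output_map S Psioo) (hFoo : extended_io_map S Foo)
  (hpassive : impedance_passive S Psioo Foo)
  (P : R[i] -> U -> U) (hP : transfer_function Foo P)
  (lambda c : R) (hlambda : 0 < lambda) (hc : 0 < c)
  (Padj : U -> U) (hPadj : is_adjoint (P lambda%:C) Padj)
  (hcoer : op_le (fun u => c%:C *: u) (fun u => P lambda%:C u + Padj u))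
  (phi : U -> U) (gamma : R) (hgamma : 0 < gamma)
  (hphi : forall u1 u2 : U,
     complex.Re (dotp (phi u2 - phi u1) (u2 - u1))
     >= gamma * rnorm (phi u2 - phi u1) ^+ 2) :
  (forall (x0 : X) (v : R -> U), L2loc v ->
     exists (x : R -> X) (y : R -> U),
       is_solution S Psioo Foo phi x0 v x y /\
       forall (x' : R -> X) (y' : R -> U),
         is_solution S Psioo Foo phi x0 v x' y' ->
         (forall t : R, 0 <= t -> x' t = x t) /\
         y' = y %[ae (@lebesgue_measure R) in halfline])
  /\
  (forall (x01 x02 : X) (v1 v2 : R -> U) (x1 x2 : R -> X) (y1 y2 : R -> U),
     L2loc v1 -> L2loc v2 ->
     is_solution S Psioo Foo phi x01 v1 x1 y1 ->
     is_solution S Psioo Foo phi x02 v2 x2 y2 ->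
     forall t : R, 0 <= t ->
       ((rnorm (x2 t - x1 t) ^+ 2)%:E
        + gamma%:E * \int[@lebesgue_measure R]_(s in `]0%R, t[)
            (rnorm (phi (v2 s - y2 s) - phi (v1 s - y1 s)) ^+ 2)%:E
        <= (rnorm (x2 0%R - x1 0%R) ^+ 2)%:E
        + (gamma^-1)%:E * \int[@lebesgue_measure R]_(s in `]0%R, t[)
            (rnorm (v2 s - v1 s) ^+ 2)%:E)%E).
Proof.
have Lphi := L2loc_phi hgamma hphi.
split=> [x0 v Lv|x01 x02 v1 v2 x1 x2 y1 y2 Lv1 Lv2 sol1 sol2 t t0]; last first.
  have [_ Ly1 _ _] := sol1; have [_ Ly2 _ _] := sol2.
  have mI := measurable_itvoo 0 t.
  have Lw := L2loc_oo t (L2loc_sub (Lphi _ (L2loc_sub Lv2 Ly2))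
    (Lphi _ (L2loc_sub Lv1 Ly1))).
  rewrite (energyE mI Lw) (energyE mI (L2loc_oo t (L2loc_sub Lv2 Lv1))).
  rewrite -!EFinM -!EFinD lee_fin.
  rewrite (is_solution_at0 hPsioo hFoo hpassive hgamma hphi Lv1 sol1).
  rewrite (is_solution_at0 hPsioo hFoo hpassive hgamma hphi Lv2 sol2).
  exact: (is_solution_estimate hPsioo hFoo hpassive hgamma hphi Lv1 Lv2 sol1 sol2).
have LP := (hPsioo x0).1.
have [w Lw Ew] := feedback_global hPsioo hFoo hpassive hgamma hphi (L2loc_sub Lv LP).
pose y s := Psioo x0 s + Foo w s.
have LF := (hFoo w Lw).1.
have Ly : L2loc y by exact: L2loc_add.
pose w' s := phi (v s - y s).
have Lw' : L2loc w' by apply: Lphi; exact: L2loc_sub.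
have ww' : w = w' %[ae (@lebesgue_measure R) in halfline].
  by apply: (ae_imply Ew) => s h /h ->; rewrite /w' /y opprD addrA.
have sol : is_solution S Psioo Foo phi x0 v (mild_state S x0 w') y.
  split => //; first exact: mild_state_continuous hPsioo hFoo hpassive _ _ Lw'.
  by apply: (ae_imply (Foo_ae hFoo Lw Lw' ww')) => s h sI; rewrite /y h.
exists (mild_state S x0 w'), y; split => // x' y' sol'.
have [_ Ly' _ Ey'] := sol'; have [_ _ _ Ey] := sol.
pose w2 s := phi (v s - y' s).
have Lw2 : L2loc w2 by apply: Lphi; exact: L2loc_sub.
have est t (t0 : 0 <= t) :=
  is_solution_estimate hPsioo hFoo hpassive hgamma hphi Lv Lv sol sol' t0.
have est0 t : 0 <= t -> rnorm (x' t - mild_state S x0 w' t) ^+ 2 + gamma *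
    energy `]0, t[ (fun s => w2 s - w' s) <= 0.
  move=> t0; apply: le_trans (est t t0) _; rewrite subrr rnorm0 expr0n add0r.
  rewrite (eq0_energy (measurable_itvoo 0 t)) ?mulr0 //.
    by case: (L2loc_oo t (L2loc_sub Lv Lv)).
  by apply: aeW => s _; rewrite subrr.
split=> [t t0|].
  have := est0 t t0; have := energy_ge0 `]0, t[ (fun s => w2 s - w' s).
  move=> /(mulr_ge0 (ltW hgamma)) g h.
  apply/eqP; rewrite -subr_eq0; apply/eqP/rnorm0_eq0/eqP.
  by rewrite -sqrf_eq0 eq_le sqr_ge0 andbT; lra.
have w2w' : w2 = w' %[ae (@lebesgue_measure R) in halfline].
  apply: ae_halfline => n; have n0 : 0 <= n.+1%:R :> R by exact: ler0n.
  have e0 : energy `]0, n.+1%:R[ (fun s => w2 s - w' s) = 0.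
    apply/eqP; rewrite eq_le energy_ge0 andbT -(ler_pM2l hgamma) mulr0.
    by apply: le_trans (est0 _ n0); rewrite lerDr sqr_ge0.
  have z := energy_eq0 (measurable_itvoo 0 _) (L2loc_oo _ (L2loc_sub Lw2 Lw')) e0.
  by apply: (ae_imply z) => s h /h /eqP; rewrite subr_eq0 => /eqP.
apply: (ae_imply2 (Foo_ae hFoo Lw2 Lw' w2w') (ae_and Ey Ey')).
by move=> s h [h1 h2] sI; rewrite h1 // h2 // h.
Qed.
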